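(* Let $\Gamma$ be a rooted tree, directed away from its root, and let $t\ge2$ be an integer; suppose that $\Delta_t(\Gamma)$ is properly-connected. Let $w=x_{i_1}\cdots x_{i_t}$ be a generator of $I_t(\Gamma)$, where $x_{i_1},\ldots,x_{i_t}$ is a path of length $t$ in $\Gamma$ and $x_{i_t}$ is a leaf of $\Gamma$. Let $F=\{x_{i_1},\ldots,x_{i_t}\}$, $$Y=\bigcup_{\substack{G\text{ a facet of }\Delta_t(\Gamma)\\ |G\cap F|=t-1}}(G\setminus F),\qquad Z=Y\cup F,\qquad a=|Y|,$$ and let $\Gamma'=\Gamma\setminus\{x_{i_t}\}$ and $\Gamma''=\Gamma\setminus Z$. Then $$\operatorname{pd}(I_t(\Gamma))=\max\{\operatorname{pd}(I_t(\Gamma')),\ \operatorname{pd}(I_t(\Gamma''))+a+1\}.$$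
   Context: A tree is a finite simple graph in which any two distinct vertices are joined by a unique path. A tree $\Gamma$ on vertices $x_1,\ldots,x_n$ is viewed as a directed graph by choosing any vertex to be the root and directing every edge away from the root. A leaf of $\Gamma$ is a vertex adjacent to exactly one other vertex. For a set $S$ of vertices, $\Gamma\setminus S$ is the directed graph obtained by deleting the vertices in $S$ and all incident edges (remaining edges keep their directions). The vertices are identified with the variables of $R=k[x_1,\ldots,x_n]$, $k$ a field. A path of length $t$ in a directed graph is a sequence of $t$ vertices $x_{i_1},\ldots,x_{i_t}$ such that $(x_{i_j},x_{i_{j+1}})$ is a directed edge for $j=1,\ldots,t-1$ (length counts vertices). For a directed graph $\Gamma$, the path ideal $I_t(\Gamma)$ is generated by the monomials $x_{i_1}\cdots x_{i_t}$ over all paths of length $t$ in $\Gamma$, and $\Delta_t(\Gamma)$ is the simplicial complex whose facets are the vertex sets of the paths of length $t$ in $\Gamma$. $\operatorname{pd}(I)$ is the projective dimension of $I$, with the convention $\operatorname{pd}((0))=-1$. Properly-connected: let $\Delta$ be a pure simplicial complex in which every facet has dimension $d$ (i.e. $d+1$ vertices; for $\Delta_t(\Gamma)$, $d+1=t$). A chain of length $n$ in $\Delta$ is a sequence $(F_0,\ldots,F_n)$ of distinct facets with $F_i\cap F_{i+1}\ne\emptyset$ for $i=0,\ldots,n-1$. It is a proper chain if $|F_i\cap F_{i+1}|=|F_{i+1}|-1$ for $i=0,\ldots,n-1$. A proper chain from $F=F_0$ to $F'=F_n$ is a proper irredundant chain if no proper subsequence of it is a proper chain from $F$ to $F'$.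 The distance $\operatorname{dist}_\Delta(F,F')$ is the minimum of the $\ell$ such that there is a proper irredundant chain $(F=F_0,\ldots,F_\ell=F')$, and $\infty$ if none exists. $\Delta$ is properly-connected if $\operatorname{dist}_\Delta(F,F')=(d+1)-|F\cap F'|$ for any two facets $F,F'$ with $F\cap F'\ne\emptyset$. *)

(* Defs.v *)
From mathcomp Require Import all_boot all_order all_algebra.
From mathcomp Require Import mpoly.
From mathcomp Require Import boolp constructive_ereal.

Set Implicit Arguments.
Unset Strict Implicit.
Unset Printing Implicit Defensive.

Import GRing.Theory.
Local Open Scope ring_scope.

(* The least natural number satisfying P, with None standing for infinity. *)
Definition least (P : nat -> Prop) : option nat :=
  match pselect (exists m, `[< P m >]) with
  | left exP => Some (ex_minn exP)
  | right _ => None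
  end.

(** Trees and directed graphs *)

Definition simple_graph (T : finType) (e : rel T) : Prop :=
  ssrbool.symmetric e /\ irreflexive e.

Definition tree (T : finType) (e : rel T) : Prop :=
  simple_graph e /\
  (forall x y : T, x != y ->
     exists! p : seq T, [/\ path e x p, uniq (x :: p) & last x p = y]).

Definition leaf (T : finType) (e : rel T) (x : T) : Prop :=
  #|[set y | e x y]| = 1%N.

(* Arcs with an endpoint outside [verts] never matter: see [dipath]. *)
Record digraph (T : finType) : Type := Digraph {
  verts : {set T};
  arcs : rel T
}.

(* In a tree, an edge uv points away from r exactly when u lies on the path
   from r to v, i.e. when u can be reached from r while avoiding v. *)
Definition rooted_tree (T : finType) (e : rel T) (r : T) : digraph T :=
  Digraph [set: T]
    [rel u v | e u v &&
       connect [rel x y | [&& e x y, x != v & y != v]] r u].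

Definition delete (T : finType) (G : digraph T) (S : {set T}) : digraph T :=
  Digraph (verts G :\: S) [rel u v | [&& arcs G u v, u \notin S & v \notin S]].

(* Paths are sequences of vertices; their length is the number of vertices. *)
Definition dipath (T : finType) (G : digraph T) (s : seq T) : bool :=
  all (mem (verts G)) s && sorted (arcs G) s.

(** Simplicial complexes, given by their set of faces *)

Definition path_complex (T : finType) (G : digraph T) (t : nat) :
    {set {set T}} :=
  [set A : {set T} | [exists s : t.-tuple T, dipath G s && (A \subset [set x in s])]].

Definition facets (T : finType) (D : {set {set T}}) : {set {set T}} :=
  [set F : {set T} | maxset (mem D) F].

Definition pure (T : finType) (D : {set {set T}}) : Prop :=
  {in facets D &, forall F F' : {set T}, #|F| = #|F'|}.

Definition chain (T : finType) (D : {set {set T}}) (c : seq {set T}) : bool :=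
  [&& all (mem (facets D)) c, uniq c
    & sorted [rel F F' | F :&: F' != set0] c].

Definition proper_chain (T : finType) (D : {set {set T}})
    (c : seq {set T}) : bool :=
  chain D c && sorted [rel F F' | #|F :&: F'| == #|F'|.-1] c.

(* The sequence F :: p is a chain of length [size p]. *)
Definition proper_chain_between (T : finType) (D : {set {set T}})
    (F F' : {set T}) (p : seq {set T}) : bool :=
  proper_chain D (F :: p) && (last F p == F').

Definition proper_irredundant_chain (T : finType) (D : {set {set T}})
    (F F' : {set T}) (p : seq {set T}) : Prop :=
  proper_chain_between D F F' p /\
  (forall q : seq {set T}, subseq (F :: q) (F :: p) -> q != p ->
     ~~ proper_chain_between D F F' q).

Definition dist (T : finType) (D : {set {set T}}) (F F' : {set T}) :
    option nat :=
  least (fun l => exists2 p : seq {set T},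
           proper_irredundant_chain D F F' p & size p = l).

(* In a pure complex of dimension d, d + 1 is the cardinality of any facet. *)
Definition properly_connected (T : finType) (D : {set {set T}}) : Prop :=
  pure D /\
  {in facets D &, forall F F' : {set T}, F :&: F' != set0 ->
     dist D F F' = Some (#|F| - #|F :&: F'|)%N}.

(** Path ideals *)

Definition ideal_generated (R : comNzRingType) (S : R -> Prop) : R -> Prop :=
  fun f => exists m (c g : 'I_m -> R),
    (forall i, S (g i)) /\ f = \sum_(i < m) c i * g i.

(* For a digraph on a subset of the vertices 'I_n, the path ideal is taken in
   the polynomial ring on all n variables. *)
Definition path_ideal (k : fieldType) (n : nat) (G : digraph 'I_n) (t : nat) :
    {mpoly k[n]} -> Prop :=
  ideal_generated (fun w : {mpoly k[n]} => exists s : t.-tuple 'I_n,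
    dipath G s /\ w = \prod_(i <- s) 'X_i).
Arguments path_ideal k {n} G t _.

(** Projective dimension *)

Definition projective (R : comNzRingType) (P : lmodType R) : Prop :=
  forall (M N : lmodType R) (f : {linear M -> N}) (g : {linear P -> N}),
    (forall y : N, exists x : M, f x = y) ->
    exists h : {linear P -> M}, forall x : P, f (h x) = g x.

(* There is an exact sequence
     0 -> P (m - 1) -> ... -> P 1 -> P 0 -> I -> 0
   with all P i projective; the sequence is continued by zero modules, and the
   augmentation onto the ideal I is composed with the inclusion of I in R. *)
Definition projective_resolution_upto (R : comNzRingType) (I : R -> Prop)
    (m : nat) : Prop :=
  exists (P : nat -> lmodType R)
         (d : forall i, {linear P i.+1 -> P i})
         (eps : {linear P 0%N -> R^o}),
    [/\ forall i, projective (P i),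
        forall i, (m <= i)%N -> forall x : P i, x = 0,
        forall f : R, I f <-> exists x, eps x = f,
        forall x, eps x = 0 <-> exists y, d 0%N y = x
      & forall i x, d i x = 0 <-> exists y, d i.+1 y = x].

(* A resolution of length l has l + 1 terms, hence the shift by one, which
   also gives pd 0 = -1.  The value is +oo if no finite resolution exists. *)
Definition pd (R : comNzRingType) (I : R -> Prop) : \bar int :=
  if least (projective_resolution_upto I) is Some m
  then (m%:Z - 1)%:E else +oo%E.

(* Main.v *)
From HB Require Import structures.
Require Import Defs.
From mathcomp Require Import all_boot all_order all_algebra.
From mathcomp Require Import freeg mpoly.
From mathcomp Require Import boolp constructive_ereal.

Set Implicit Arguments.
Unset Strict Implicit.
Unset Printing Implicit Defensive.

Import GRing.Theory.
Local Open Scope ring_scope.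

(* Let x be the leaf ending the path F, v the product of the other vertices of
   F, J = I_t(Gamma') and L = (J : v), so that I = I_t(Gamma) = J + (x v) and x
   occurs neither in J nor in L.

   Setting x = 0 gives pd I = max (pd J, pd R/L).  Indeed J -> I -> R/L is an
   extension.  Conversely, present I on generators of J free of x together with
   x v, resolve by free modules, and apply the substitution x = 0 to all
   matrices: since x is regular on I and its syzygies, this stays exact, and it
   resolves J + R/L (direct sum), because a syzygy (f, r) of (J, x v) has
   r v in J and f a syzygy of J modulo x.

   As the complex is properly connected, a path meeting F but different from F
   contains an element of Y, so L = I_t(Gamma'') + (Y).  The same identity with
   v = 1 shows that adjoining one variable of Y to an ideal not involving it
   raises the projective dimension of the quotient by exactly one.

   Modules are handled as pairs S <= F standing for F/S with F projective. *)

(** * Free and projective modules *)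

Section LinearMaps.
Context (R : comNzRingType).
Implicit Types A B F M N P Q U V : lmodType R.

Definition mklin U V (f : U -> V)
    (fL : forall a x y, f (a *: x + y) = a *: f x + f y) : {linear U -> V} :=
  HB.pack f (GRing.isLinear.Build R U V *:%R f fL).

Lemma mklinE U V (f : U -> V) fL x : @mklin U V f fL x = f x.
Proof. by []. Qed.

Definition submodule F (S : F -> Prop) :=
  S 0 /\ forall a x y, S x -> S y -> S (a *: x + y).

Lemma submoduleD F (S : F -> Prop) x y :
  submodule S -> S x -> S y -> S (x + y).
Proof. by move=> [_ SD] Sx Sy; rewrite -[x]scale1r; apply: SD. Qed.

Lemma submoduleZ F (S : F -> Prop) a x : submodule S -> S x -> S (a *: x).
Proof. by move=> [S0 SD] Sx; rewrite -[_ *: _]addr0; apply: SD. Qed.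

Lemma submoduleN F (S : F -> Prop) x : submodule S -> S x -> S (- x).
Proof. by move=> SS Sx; rewrite -scaleN1r; apply: submoduleZ. Qed.

Lemma submoduleB F (S : F -> Prop) x y :
  submodule S -> S x -> S y -> S (x - y).
Proof. by move=> SS Sx Sy; apply: submoduleD => //; apply: submoduleN. Qed.

Lemma submodule_ker U V (f : {linear U -> V}) : submodule (fun x => f x = 0).
Proof.
split=> [|a x y fx fy]; first exact: linear0.
by rewrite linearP fx fy scaler0 addr0.
Qed.

Lemma submodule_im U V (f : {linear U -> V}) :
  submodule (fun y => exists x, f x = y).
Proof.
split=> [|a _ _ [x <-] [y <-]]; first by exists 0; exact: linear0.
by exists (a *: x + y); rewrite linearP.
Qed.

(* The universal property is stated for s-semilinear maps, so that it also
   yields the map applying s to all coordinates. *)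
Definition free_basis F (I : Type) (b : I -> F) : Prop :=
  [/\ forall (s : {rmorphism R -> R}) M (g : I -> M), exists f : F -> M,
        [/\ {morph f : x y / x + y}, forall a x, f (a *: x) = s a *: f x
          & forall i, f (b i) = g i],
      forall C : F -> Prop, C 0 -> (forall a i x, C x -> C (a *: b i + x)) ->
        forall x, C x
    & forall a, GRing.lreg a -> forall x : F, a *: x = 0 -> x = 0].

(** Realised by finitely supported formal sums, over [{classic I}] because [I] need not have
    decidable equality. *)
Lemma free_exists (I : Type) : exists F (b : I -> F), free_basis b.
Proof.
pose K := {classic I}; exists {freeg K / R}, (fun i : K => << i >>).
split=> [s M g|C C0 CD x|a areg x].
- pose f (x : {freeg K / R}) := \sum_(z <- dom x) s (coeff z x) *: g z.
  have fE (r : seq K) (x : {freeg K / R}) : uniq r -> {subset dom x <= r} ->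
      f x = \sum_(z <- r) s (coeff z x) *: g z.
    move=> r_uniq sub; rewrite /f [RHS](bigID (mem (dom x))) /=.
    rewrite [X in _ + X]big1 ?addr0; last first.
      by move=> z /coeff_outdom ->; rewrite rmorph0 scale0r.
    rewrite -[RHS]big_filter; apply: perm_big; apply: uniq_perm;
      rewrite ?filter_uniq //.
      exact: uniq_dom.
    by move=> z; rewrite mem_filter; case: (boolP (z \in dom x)) => // /sub ->.
  exists f; split=> [x y|a x|i].
  + pose r := undup (dom x ++ dom y).
    rewrite !(fE r) ?undup_uniq // /r => [|z|z|z].
    * rewrite -big_split; apply: eq_bigr => z _ /=.
      by rewrite coeffD rmorphD scalerDl.
    * by rewrite mem_undup mem_cat orbC => ->.
    * by rewrite mem_undup mem_cat => ->.
    * by move/domD_subset; rewrite mem_undup.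
  + rewrite (fE (dom x)) ?uniq_dom //; last exact: domZ_subset.
    rewrite scaler_sumr; apply: eq_bigr => z _ /=.
    by rewrite coeffZ rmorphM scalerA.
  + by rewrite /f domU1 big_seq1 coeffU eqxx mulr1 rmorph1 scale1r.
- rewrite -(freeg_sumE x); elim: (dom x) => [|z r IH]; rewrite ?big_nil //.
  rewrite big_cons; have -> : << coeff z x *g z >> =
      coeff z x *: << (z : K) >> :> {freeg K / R}; last exact: CD.
  by apply/eqP/freeg_eqP => y; rewrite coeffZ !coeffU mul1r.
- move=> ax0; apply/eqP/freeg_eqP => z; apply: areg.
  by rewrite -coeffZ ax0 !coeff0 mulr0.
Qed.

Lemma free_lift F I (b : I -> F) M (g : I -> M) : free_basis b ->
  exists f : {linear F -> M}, forall i, f (b i) = g i.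
Proof.
case=> /(_ idfun M g)[f [fD fZ fb]] _ _.
by unshelve eexists (@mklin _ _ f _) => //= a x y; rewrite fD fZ.
Qed.

Lemma free_ext F I (b : I -> F) M (f g : F -> M) (s : R -> R) : free_basis b ->
  {morph f : x y / x + y} -> {morph g : x y / x + y} ->
  (forall a x, f (a *: x) = s a *: f x) ->
  (forall a x, g (a *: x) = s a *: g x) ->
  (forall i, f (b i) = g (b i)) -> f =1 g.
Proof.
case=> _ ind _ fD gD fZ gZ fg x.
have add0 (h : F -> M) : {morph h : x y / x + y} -> h 0 = 0.
  by move=> hD; apply: (@addrI _ (h 0)); rewrite -hD !addr0.
apply: (ind (fun x => f x = g x)) => [|a i y IH]; first by rewrite !add0.
by rewrite fD gD fZ gZ fg IH.
Qed.

Lemma free_cover F (S : F -> Prop) : submodule S ->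
  exists P (I : Type) (b : I -> P) (d : {linear P -> F}),
    free_basis b /\ forall x, S x <-> exists y, d y = x.
Proof.
move=> SS; have [P [b bP]] := free_exists {x : F | S x}.
have [d dE] := free_lift (fun x => sval x) bP; exists P, _, b, d; split=> // x.
split=> [Sx|[y <-]]; first by exists (b (exist _ x Sx)).
case: bP => _ ind _; apply: (ind (fun y => S (d y))) => [|a i z Sz].
  by rewrite linear0; case: SS.
by rewrite linearP dE; apply: SS.2 Sz; apply: (svalP i).
Qed.

(** Lifting through a linear relation instead of a surjection: choose values on the basis of a free
    module covering [P], then compose with a splitting of this cover. *)
Lemma projective_lift P A B (T : A * B -> Prop) (g : {linear P -> B}) :
  projective P -> submodule T -> (forall x, exists a, T (a, g x)) ->
  exists h : {linear P -> A}, forall x, T (h x, g x).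
Proof.
move=> Pproj TS gT.
have [F [J [b [f [bF fS]]]]] : exists F J (b : J -> F) (f : {linear F -> P}),
    free_basis b /\ forall x, True <-> exists y, f y = x.
  exact: free_cover.
have [s fs] := Pproj _ _ f idfun (fun y => proj1 (fS y) I).
have [k kE] := choice (fun i => gT (f (b i))).
have [h hE] := free_lift k bF.
have hT y : T (h y, g (f y)).
  case: bF => _ ind _; apply: (ind (fun y => T (h y, g (f y)))) => [|a i z].
    by rewrite !linear0; case: TS.
  by move=> /(TS.2 a _ _ (kE i)); rewrite !linearP hE.
by exists (h \o s) => x; have := hT (s x); rewrite (fs x : f (s x) = x).
Qed.

Lemma projective_factor P A B (d : {linear A -> B}) (g : {linear P -> B}) :
  projective P -> (forall x, exists a, d a = g x) ->
  exists h : {linear P -> A}, forall x, d (h x) = g x.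
Proof.
move=> Pproj; apply: (projective_lift (T := fun u => d u.1 = u.2)) => //.
split=> [|a [x1 x2] [y1 y2] /= <- <-]; first exact: linear0.
by rewrite linearP.
Qed.

Lemma free_projective F I (b : I -> F) : free_basis b -> projective F.
Proof.
move=> bF M N f g fS.
have [k kE] := choice (fun i => fS (g (b i))).
have [h hE] := free_lift k bF; exists h.
apply: (free_ext bF) => [x y|x y|a x|a x|i]; rewrite ?linearD ?linearZ //=.
by rewrite hE.
Qed.

Lemma projective_unit : projective (R^o : lmodType R).
Proof.
move=> M N f g fS; have [x fx] := fS (g 1).
have L a (r r' : R^o) : (a *: r + r') *: x = a *: (r *: x) + r' *: x.
  by rewrite scalerDl scalerA.
exists (mklin L) => r /=; rewrite linearZ fx -linearZ; congr (g _).
exact: mulr1.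
Qed.

Lemma projective_prod P Q : projective P -> projective Q ->
  projective (P * Q)%type.
Proof.
move=> Pproj Qproj M N f g fS.
have L1 a (x y : P) : g (a *: x + y, 0) = a *: g (x, 0) + g (y, 0).
  by rewrite -linearP; congr (g _); apply/pair_equal_spec; rewrite /= scaler0 addr0.
have L2 a (x y : Q) : g (0, a *: x + y) = a *: g (0, x) + g (0, y).
  by rewrite -linearP; congr (g _); apply/pair_equal_spec; rewrite /= scaler0 addr0.
have [h1 h1E] := Pproj _ _ f (mklin L1) fS.
have [h2 h2E] := Qproj _ _ f (mklin L2) fS.
have L a (u v : P * Q) : h1 (a *: u + v).1 + h2 (a *: u + v).2 =
    a *: (h1 u.1 + h2 u.2) + (h1 v.1 + h2 v.2).
  by rewrite /= !linearP scalerDr addrACA.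
exists (mklin L) => -[x y]; rewrite mklinE /= linearD h1E h2E !mklinE -linearD.
by congr (g _); apply/pair_equal_spec; rewrite /= addr0 add0r.
Qed.

Lemma projective_retract P Q (i : {linear P -> Q}) (r : {linear Q -> P}) :
  projective Q -> cancel i r -> projective P.
Proof.
move=> Qproj ir M N f g fS.
have [h hE] := Qproj _ _ f (g \o r) fS.
by exists (h \o i) => x /=; rewrite hE /= ir.
Qed.

End LinearMaps.

(** * Projective dimension of quotients of projective modules *)

Section QuotientDimension.
Context (R : comNzRingType).
Implicit Types F P Q : lmodType R.

(* For a submodule S of a projective module F, the quotient F/S has projective
   dimension at most m. *)
Fixpoint qdim_le (m : nat) F (S : F -> Prop) : Prop :=
  if m is m'.+1 then
    exists P (d : {linear P -> F}),
      [/\ projective P, forall x, S x <-> exists y, d y = x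
        & qdim_le m' (fun y => d y = 0)]
  else exists e : {linear F -> F}, (forall x, S (e x)) /\ forall x, S x -> e x = x.

Lemma qdim_le_ext m F (S T : F -> Prop) :
  (forall x, S x <-> T x) -> qdim_le m S -> qdim_le m T.
Proof.
move=> ST; case: m => [|m] /=.
  by move=> [e [eS eid]]; exists e; split=> x; rewrite -ST; [apply: eS|apply: eid].
by move=> [P [d [Pproj dS dm]]]; exists P, d; split=> // x; rewrite -ST.
Qed.

(** In the base case [e] projects onto [S], so [e] itself covers [S], and its kernel is the
    complementary summand, split off by [x - e x]. *)
Lemma qdim_leS m F (S : F -> Prop) :
  projective F -> qdim_le m S -> qdim_le m.+1 S.
Proof.
elim: m F S => [|m IH] F S Fproj; last first.
  by move=> [P [d [Pproj dS dm]]]; exists P, d; split=> //; apply: IH.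
move=> [e [eS eid]]; exists F, e; split=> // [x|].
  by split=> [/eid ex|[y <-] //]; exists x.
have L a x y : (a *: x + y) - e (a *: x + y) = a *: (x - e x) + (y - e y).
  by rewrite linearP scalerBr opprD addrACA.
exists (mklin L); split=> x; rewrite mklinE; last by move=> ->; rewrite subr0.
by rewrite linearB /= (eid (e x)) ?subrr.
Qed.

Lemma qdim_le_add m k F (S : F -> Prop) :
  projective F -> qdim_le m S -> qdim_le (m + k) S.
Proof.
by move=> Fproj; elim: k => [|k IH]; rewrite ?addn0 // addnS => /IH/qdim_leS; apply.
Qed.

Lemma qdim_le_inl m P Q (S : P -> Prop) :
  qdim_le m S -> qdim_le m (fun u : P * Q => S u.1 /\ u.2 = 0).
Proof.
case: m => [[e [eS eid]]|m [P' [d [P'proj dS dm]]]].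
  have L a (u v : P * Q) : (e (a *: u + v).1, 0 : Q) =
      a *: (e u.1, 0) + (e v.1, 0).
    by apply/pair_equal_spec; rewrite /= linearP scaler0 addr0.
  exists (mklin L); split=> [u|[x y] /= [Sx ->]] //=.
  by rewrite /= eid.
have L a (x y : P') : (d (a *: x + y), 0 : Q) = a *: (d x, 0) + (d y, 0).
  by apply/pair_equal_spec; rewrite /= linearP scaler0 addr0.
exists P', (mklin L); split=> //; last first.
  apply: qdim_le_ext dm => y; rewrite mklinE.
  by split=> [->|[]].
move=> [x y] /=; split; first by move=> [/dS[z <-] ->]; exists z.
by move=> [z]; rewrite /= => -[<- <-]; split=> //; apply/dS; exists z.
Qed.

(* If F/S is a retract of F'/S' and d' : P' -> F' covers S', then
   (p, y) |-> be (d' p) + (be (al y) - y) covers S, and its kernel is again a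
   retract, of ker d' x 0 in P' x F.  This contains Schanuel's lemma. *)
Lemma qdim_le_retract m F F' (S : F -> Prop) (S' : F' -> Prop)
    (al : {linear F -> F'}) (be : {linear F' -> F}) :
  projective F -> submodule S ->
  (forall x, S x -> S' (al x)) -> (forall x, S' x -> S (be x)) ->
  (forall x, S (be (al x) - x)) -> qdim_le m S' -> qdim_le m S.
Proof.
elim: m F F' S S' al be => [|m IH] F F' S S' al be Fproj SS alS beS albe.
  move=> [e [eS eid]].
  (* The value [x - be (al x - e (al x))] differs from [be (e (al x))] by an element of [S], and it
     is [x] for [x] in [S] because [e] fixes [S']. *)
  exists (idfun \- (be \o (al \- (e \o al)))); split=> x /=.
    rewrite linearB opprB addrCA -opprB; apply: submoduleB => //.
    exact/beS/eS.
  by move=> /alS/eid ->; rewrite subrr linear0 subr0.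
move=> [P' [d' [P'proj d'S' d'm]]].
have [d dE] : exists d : {linear (P' * F)%type -> F},
    forall u, d u = be (d' u.1) + (be (al u.2) - u.2).
  by exists ((be \o d' \o fst) \+ ((be \o al \o snd) \- snd)).
have Qproj : projective (P' * F)%type by apply: projective_prod.
have dS x : S x <-> exists y, d y = x.
  split=> [Sx|[y <-]]; last first.
    by rewrite dE; apply: submoduleD => //; apply/beS/d'S'; exists y.1.
  have [p pE] := (d'S' (al x)).1 (alS _ Sx).
  by exists (p, - x); rewrite dE /= pE !linearN opprK addNKr.
exists _, d; split=> //.
(* With [h] lifting [al \o d] through [d'], the kernels are compared by u |-> (h u, - d u) and the
   identity; [d] takes the same value on u and on its image. *)
have [h hE] : exists h : {linear (P' * F)%type -> P'}, forall x, d' (h x) = al (d x).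
  apply: (@projective_factor _ _ _ _ d' (al \o d)) => // x.
  by apply/d'S'/alS/dS; exists x.
have L a (u v : P' * F) : (h (a *: u + v), - d (a *: u + v)) =
    a *: (h u, - d u) + (h v, - d v).
  by rewrite linearP [d _]linearP opprD -scalerN.
apply: (IH _ _ _ (fun u : P' * F => d' u.1 = 0 /\ u.2 = 0) (mklin L) idfun) => //.
- exact: submodule_ker.
- by move=> u du; rewrite /= hE du linear0 oppr0.
- by move=> [p y] /= [d'p ->]; rewrite dE /= d'p !linear0 !addr0.
- move=> u; rewrite linearB /= [X in X - _]dE /= hE.
  by rewrite !linearN opprK addNKr subrr.
- exact: qdim_le_inl d'm.
Qed.

(** Schanuel's lemma: lifts between two projective covers of [S] compose to the identity modulo the
    kernel, so any cover may start the resolution. *)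
Lemma qdim_le_cover m F (S : F -> Prop) Q (d : {linear Q -> F}) :
  projective Q -> (forall x, S x <-> exists y, d y = x) ->
  qdim_le m.+1 S -> qdim_le m (fun y => d y = 0).
Proof.
move=> Qproj dS [P [d' [Pproj d'S dm]]].
have [h hE] : exists h : {linear Q -> P}, forall x, d' (h x) = d x.
  by apply: projective_factor => // x; apply/d'S/dS; exists x.
have [k kE] : exists k : {linear P -> Q}, forall x, d (k x) = d' x.
  by apply: projective_factor => // x; apply/dS/d'S; exists x.
apply: (qdim_le_retract (al := h) (be := k)) dm => //.
- exact: submodule_ker.
- by move=> x dx; rewrite hE.
- by move=> x dx; rewrite kE.
- by move=> x; rewrite linearB /= kE hE subrr.
Qed.

(** Horseshoe lemma: (F x F')/T is an extension of F'/S' by F/S, and a lift [h] completes the second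
    coordinates to elements of [T]. *)
Lemma qdim_le_extension m F F' (T : F * F' -> Prop) (S : F -> Prop)
    (S' : F' -> Prop) : projective F' -> submodule T ->
  (forall x, S x <-> T (x, 0)) -> (forall y, S' y <-> exists x, T (x, y)) ->
  qdim_le m S -> qdim_le m S' -> qdim_le m T.
Proof.
elim: m F F' T S S' => [|m IH] F F' T S S' F'proj TT TS TS'.
  move=> [e [eS eid]] [e' [e'S' e'id]].
  have [h hE] : exists h : {linear F' -> F}, forall y, T (h y, e' y).
    by apply: projective_lift => // y; apply/TS'.
  have L a (u v : F * F') :
      (h (a *: u + v).2 + e ((a *: u + v).1 - h (a *: u + v).2), e' (a *: u + v).2) =
      a *: (h u.2 + e (u.1 - h u.2), e' u.2) + (h v.2 + e (v.1 - h v.2), e' v.2).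
    have -> : (a *: u + v).1 - h (a *: u + v).2 =
        a *: (u.1 - h u.2) + (v.1 - h v.2).
      by rewrite /= [h _]linearP scalerBr opprD addrACA.
    apply/pair_equal_spec; split; rewrite /= !linearP //.
    by rewrite scalerDr addrACA.
  exists (mklin L); split=> [[x y]|[x y] Txy]; rewrite /=.
    rewrite -[e' y]addr0 -[(_ + _, _)]/((h y, e' y) + (e (x - h y), 0)).
    by apply: submoduleD => //; apply/TS.
  have e'y : e' y = y by apply/e'id/TS'; exists x.
  rewrite e'y eid ?[_ + (_ - _)]addrC ?subrK //.
  have := submoduleB TT Txy (hE y); rewrite e'y => Tz.
  by apply/TS; rewrite -(subrr y).
move=> [P [d [Pproj dS dm]]] [P' [d' [P'proj d'S' d'm]]].
have [h hE] : exists h : {linear P' -> F}, forall y, T (h y, d' y).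
  by apply: projective_lift => // y; apply/TS'/d'S'; exists y.
have L a (u v : P * P') : (d (a *: u + v).1 + h (a *: u + v).2, d' (a *: u + v).2) =
    a *: (d u.1 + h u.2, d' u.2) + (d v.1 + h v.2, d' v.2).
  by apply/pair_equal_spec; split; rewrite /= !linearP // scalerDr addrACA.
have SE x y p : d' p = y -> T (x, y) <-> S (x - h p).
  move=> <-; rewrite TS; split=> [Tx|].
    by have := submoduleB TT Tx (hE p); rewrite -[_ - _]/(x - h p, d' p - d' p) subrr.
  move=> /(submoduleD TT)/(_ (hE p)).
  by rewrite -[_ + _]/(x - h p + h p, 0 + d' p) subrK add0r.
exists _, (mklin L); split=> [||].
- exact: projective_prod.
- move=> [x y]; split=> [Txy|[[p p']]].
    have [p' p'E] : exists p', d' p' = y by apply/d'S'/TS'; exists x.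
    have /dS[p pE] := (SE _ _ _ p'E).1 Txy.
    by exists (p, p'); rewrite /= p'E pE subrK.
  rewrite /= => -[<- <-]; rewrite SE // addrK; apply/dS; by exists p.
- apply: IH dm d'm => //; first exact: submodule_ker.
    by move=> p; rewrite /= !linear0 addr0; split=> [->|[]].
  move=> p'; split=> [d'p'|[p]]; last by rewrite /= => -[].
  have /dS[p pE] : S (0 - h p') by apply: (SE _ _ _ d'p').1; case: TT.
  by exists p; rewrite /= pE d'p' add0r addNr.
Qed.

End QuotientDimension.

(** * Killing a variable in a free resolution *)

Section BaseChange.
Context (R : comNzRingType).
Implicit Types F P Q M N : lmodType R.

(** Horner form of a finite expansion f_0 + x f_1 + x^2 f_2 + ... whose coefficients are all fixed
    by [u]. *)
Inductive xexpansion (x : R) F (u : F -> F) : F -> Prop :=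
| XExpansion0 : xexpansion x u 0
| XExpansionS f z : u f = f -> xexpansion x u z -> xexpansion x u (f + x *: z).

(* [s] is the retraction of [R] onto its subring of s-fixed elements killing
   [x], and [R] is the polynomial ring in [x] over this subring. *)
Definition polynomial_in (x : R) (s : {rmorphism R -> R}) : Prop :=
  [/\ GRing.lreg x, s x = 0 & forall r : R^o, xexpansion x (s : R^o -> R^o) r].

Definition slinear (s : R -> R) M N (f : M -> N) : Prop :=
  {morph f : y z / y + z} /\ forall a z, f (a *: z) = s a *: f z.

Lemma slinear0 s M N (f : M -> N) : slinear s f -> f 0 = 0.
Proof. by move=> [fD _]; apply: (@addrI _ (f 0)); rewrite -fD !addr0. Qed.

Lemma slinearB (s : {rmorphism R -> R}) M N (f : M -> N) y z :
  slinear s f -> f (y - z) = f y - f z.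
Proof. by move=> [fD fZ]; rewrite fD -scaleN1r fZ rmorphN1 scaleN1r. Qed.

Lemma slinear_unit (s : {rmorphism R -> R}) :
  slinear s (s : R^o -> R^o).
Proof. by split=> [y z|a z]; rewrite ?rmorphD ?rmorphM. Qed.

(** The image of a submodule under a semilinear map need not be closed under scalars; this is the
    smallest submodule containing it, as an intersection. *)
Definition submod_span M (S : M -> Prop) (z : M) : Prop :=
  forall T : M -> Prop, submodule T -> (forall y, S y -> T y) -> T z.

Lemma submodule_submod_span M (S : M -> Prop) : submodule (submod_span S).
Proof.
split=> [T [] //|a y z Sy Sz T TT ST].
by apply: TT.2; [apply: Sy|apply: Sz].
Qed.

Section Variable_x.
Context (x : R) (s : {rmorphism R -> R}) (xs : polynomial_in x s).

(** Since [s x = 0], applying [u] keeps only the constant coefficient; in particular [u] is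
    idempotent on expansions. *)
Lemma xexpansion_coef0 F (u : F -> F) z : slinear s u -> xexpansion x u z ->
  exists y, z = u z + x *: y /\ u (u z) = u z.
Proof.
move=> us; have u0 := slinear0 us; case: us => uD uZ.
case=> [|f y fu _].
  by exists 0; rewrite u0 scaler0 addr0 u0.
by exists y; have [_ sx _] := xs; rewrite uD uZ fu sx scale0r addr0.
Qed.

Lemma xexpansionD F (u : F -> F) y z : {morph u : y z / y + z} ->
  xexpansion x u y -> xexpansion x u z -> xexpansion x u (y + z).
Proof.
move=> uD hy; elim: hy z => {y} [|f y uf hy IH] z; first by rewrite add0r.
case=> {z} [|g z ug hz]; first by rewrite addr0; apply: XExpansionS.
rewrite addrACA -scalerDr; apply: XExpansionS; last exact: IH.
by rewrite uD uf ug.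
Qed.

Lemma free_xexpansion F I (b : I -> F) (u : F -> F) z : free_basis b ->
  slinear s u -> (forall i, u (b i) = b i) -> xexpansion x u z.
Proof.
move=> [_ ind _] us ub; have [uD uZ] := us.
apply: (ind (xexpansion x u)) => [|a i y hy]; first exact: XExpansion0.
apply: xexpansionD => //.
have [_ _ /(_ a)] := xs; elim=> {a} [|f a fs _ IH].
  by rewrite scale0r; apply: XExpansion0.
by rewrite scalerDl -scalerA; apply: XExpansionS => //; rewrite uZ ub fs.
Qed.

(* The base change of an exact sequence of free modules along [s] stays exact
   because [x] is regular on the modules resolved. *)
Lemma qdim_le_base_change m F I (b : I -> F) (u : F -> F) (S : F -> Prop) :
  free_basis b -> slinear s u -> (forall i, u (b i) = b i) ->
  submodule S -> (forall z, S (x *: z) -> S z) ->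
  qdim_le m S -> qdim_le m (submod_span (fun z => exists2 y, S y & u y = z)).
Proof.
elim: m F I b u S => [|m IH] F I b u S bF us ub SS Sx.
  move=> [e [eS eid]]; have [g gE] := free_lift (fun i => u (e (b i))) bF.
  have gu z : g (u z) = u (e z).
    have [uD uZ] := us.
    apply: (free_ext (f := g \o u) (g := u \o e) (s := s) bF)
      => [y y'|y y'|a y|a y|i] /=; by rewrite ?uD ?uZ ?linearD ?linearZ ?uD ?uZ ?ub ?gE.
  exists g; split=> z.
    move=> T TT ST; case: (bF) => _ ind _.
    apply: (ind (fun z => T (g z))) => [|a i y Ty].
      by rewrite linear0; case: TT.
    by rewrite linearP; apply: TT.2 => //; apply: ST; exists (e (b i)).
  move/(_ (fun z => g z = z)); apply=> [|_ [y Sy <-]]; last by rewrite gu eid.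
  by split=> [|a y y' gy gy']; rewrite ?linear0 // linearP gy gy'.
move=> Sm; have [Q [J [c [d [cQ dS]]]]] := free_cover SS.
have [u' [u'D u'Z u'c]] : exists u' : Q -> Q,
    [/\ {morph u' : y z / y + z}, forall a z, u' (a *: z) = s a *: u' z
      & forall j, u' (c j) = c j] by case: cQ => + _ _; apply.
have u's : slinear s u' by [].
have [g gE] := free_lift (fun j => u (d (c j))) cQ.
have [uD uZ] := us.
have gu z : g (u' z) = u (d z).
  apply: (free_ext (f := g \o u') (g := u \o d) (s := s) cQ)
    => [y y'|y y'|a y|a y|i] /=; by rewrite ?u'D ?u'Z ?linearD ?linearZ ?uD ?uZ ?u'c ?gE.
have uu z : u (u z) = u z.
  have [? [_ ->]] // := xexpansion_coef0 us (free_xexpansion z bF us ub).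
have kerd : qdim_le m (submod_span (fun z => exists2 y, d y = 0 & u' y = z)).
  apply: (IH _ _ c u') => //; first exact: submodule_ker.
    by move=> z; rewrite linearZ /=; case: bF xs => _ _ reg [/reg xreg _ _] /xreg.
  exact: qdim_le_cover (free_projective cQ) dS Sm.
exists Q, g; split; first exact: free_projective cQ.
  move=> z; split=> [|[y <-] T TT ST].
    move/(_ _ (submodule_im g)); apply=> _ [_ /dS[q <-] <-].
    by exists (u' q).
  case: (cQ) => _ ind _; apply: (ind (fun y => T (g y))) => [|a j y' Ty'].
    by rewrite linear0; case: TT.
  rewrite linearP; apply: TT.2 => //; rewrite gE; apply: ST.
  by exists (d (c j)) => //; apply/dS; exists (c j).
apply: qdim_le_ext kerd => z; split.
  move/(_ _ (submodule_ker g)); apply=> _ [y dy <-].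
  by rewrite gu dy (slinear0 us).
have SP := submodule_submod_span (fun z => exists2 y, d y = 0 & u' y = z).
have [_ sx0 _] := xs.
(* A cycle of [g] is treated one coefficient at a time: [g f] is fixed by [u], so applying [u] shows
   that the constant coefficient is itself a cycle, and [x] cancels from the rest. *)
elim: (free_xexpansion z cQ u's u'c) => {z} [|f z fu' _ IHz] gz; first by case: SP.
have gf0 : g f = 0.
  have : u (g (f + x *: z)) = 0 by rewrite gz (slinear0 us).
  by rewrite linearD linearZ /= uD uZ sx0 scale0r addr0 -fu' gu uu.
have gz0 : g z = 0.
  move: gz; rewrite linearD gf0 add0r linearZ /=.
  by case: bF xs => _ _ reg [/reg xreg _ _] /xreg.
apply: (submoduleD SP); last by apply: (submoduleZ _ SP); apply: IHz.
(* The constant coefficient of [d f] vanishes, so [d f] is x h with h in [S]; lifting h to q gives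
   the syzygy [f - x *: q], which [u'] sends to [f]. *)
have [h [dfE _]] := xexpansion_coef0 us (free_xexpansion (d f) bF us ub).
have udf : u (d f) = 0 by rewrite -gu fu'.
have [q qE] : exists q, d q = h.
  by apply/dS/Sx; move: dfE; rewrite udf add0r => <-; apply/dS; exists f.
move=> T _; apply; exists (f - x *: q).
  by rewrite linearB linearZ /= qE dfE udf add0r subrr.
by rewrite (slinearB _ _ u's) u'Z sx0 scale0r subr0.
Qed.

End Variable_x.
End BaseChange.

(** * Adjoining one generator to an ideal *)

Section Ideals.
Context (R : comNzRingType).
Implicit Types (I J L : R^o -> Prop) (f g v w r : R).

Definition add_principal J w : R^o -> Prop :=
  fun f => exists g r, J g /\ f = g + r * w.

Definition colon J w : R^o -> Prop := fun r => J (r * w).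

Lemma submodule_generated (S : R -> Prop) :
  submodule (ideal_generated S : R^o -> Prop).
Proof.
split=> [|a _ _ [m [c [g [Sg ->]]]] [m' [c' [g' [Sg' ->]]]]].
  by exists 0%N, (fun=> 0), (fun=> 0); split=> [[]|]; rewrite ?big_ord0.
exists (m + m')%N, (fun i => match split i with inl j => a * c j | inr j => c' j end),
  (fun i => match split i with inl j => g j | inr j => g' j end).
split=> [i|]; first by case: split.
rewrite big_split_ord /= scaler_sumr; congr (_ + _); apply: eq_bigr => i _.
  by rewrite (unsplitK (inl i)); apply: mulrA.
by rewrite (unsplitK (inr i)).
Qed.

Lemma generated_gen (S : R -> Prop) g : S g -> ideal_generated S g.
Proof.
by exists 1%N, (fun=> 1), (fun=> g); split=> //; rewrite big_ord1 mul1r.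
Qed.

Lemma generated_min (S : R -> Prop) J : submodule J ->
  (forall g, S g -> J g) -> forall f, ideal_generated S f -> J f.
Proof.
move=> JJ SJ f [m [c [g [Sg ->]]]].
elim/big_rec: _ => [|i y _ Jy]; first by case: JJ.
by apply: JJ.2 => //; apply: SJ.
Qed.

Lemma add_principalP J w : submodule J ->
  submodule (add_principal J w) /\
  forall K : R^o -> Prop, submodule K -> (forall f, J f -> K f) -> K w ->
    forall f, add_principal J w f -> K f.
Proof.
move=> JJ; split=> [|K KK JK Kw _ [g [r [/JK Kg ->]]]]; last first.
  by rewrite addrC; apply: KK.2.
split=> [|a _ _ [g [r [Jg ->]]] [g' [r' [Jg' ->]]]].
  by exists 0, 0; rewrite mul0r addr0; split=> //; case: JJ.
exists (a * g + g'), (a * r + r'); split; first exact: JJ.2.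
by rewrite /= scalerDr addrACA mulrDl -mulrA.
Qed.

(* The extension 0 -> J -> I -> R/(J : w) -> 0 for I = J + (w). *)
Lemma qdim_le_add_principal p J w : submodule J ->
  qdim_le p.+1 J -> qdim_le p (colon J w) -> qdim_le p.+1 (add_principal J w).
Proof.
move=> JJ [P [d [Pproj dJ dm]]] cm.
have [D DE] : exists D : {linear (P * R^o)%type -> R^o},
    forall u, D u = d u.1 + u.2 * w.
  have L a (u v : P * R^o) : d (a *: u + v).1 + (a *: u + v).2 * w =
      a *: (d u.1 + u.2 * w) + (d v.1 + v.2 * w).
    by rewrite /= linearP scalerDr addrACA mulrDl -mulrA.
  by exists (mklin L).
exists _, D; split=> [||].
- by apply: projective_prod => //; apply: projective_unit.
- move=> f; split=> [[g [r [/dJ[y <-] ->]]]|[[y r] <-]].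
    by exists (y, r); rewrite DE.
  by exists (d y), r; rewrite DE; split=> //; apply/dJ; exists y.
(* The kernel of [D] meets P x 0 in the kernel of [d] and projects onto [colon J w]. *)
apply: qdim_le_extension dm cm; [exact: projective_unit|exact: submodule_ker| |].
  by move=> y; rewrite DE /= mul0r addr0.
move=> r; split=> [/dJ[y yE]|[y]].
  by exists (- y); rewrite DE /= linearN yE addNr.
rewrite DE /= => /eqP; rewrite addrC addr_eq0 => /eqP yE.
by apply/dJ; exists (- y); rewrite linearN.
Qed.

Context (x : R) (s : {rmorphism R -> R}) (xs : polynomial_in x s).

(** Ideals extended from the subring fixed by [s]: they are stable under [s], and [x] is regular
    modulo them. *)
Definition extended_ideal J : Prop :=
  [/\ submodule J, forall r, J r -> J (s r) & forall r, J (x * r) -> J r].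

(** For saturation, split each coefficient as [s c + x * c']: the parts [s c] sum to s (x r) = 0,
    and cancelling [x] leaves [r] as a combination of the same generators. *)
Lemma extended_generated (S : R -> Prop) :
  (forall g, S g -> s g = g) -> extended_ideal (ideal_generated S).
Proof.
move=> Ss; have SS := submodule_generated S; split=> // r [m [c [g [Sg rE]]]].
  rewrite rE rmorph_sum; exists m, (fun i => s (c i)), g; split=> //.
  by apply: eq_bigr => i _; rewrite rmorphM /= (Ss _ (Sg i)).
have cE i : exists c', c i = s (c i) + x * c'.
  have [_ _ /(_ (c i))h] := xs.
  by have [c' [? _]] := xexpansion_coef0 xs (slinear_unit s) h; exists c'.
have [c' c'E] := choice cE; exists m, c', g; split=> //.
have [xreg sx0 _] := xs; apply: xreg; rewrite rE mulr_sumr.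
rewrite (eq_bigr (fun i => s (c i) * g i + x * (c' i * g i))); last first.
  by move=> i _; rewrite {1}c'E mulrDl mulrA.
rewrite big_split /=; have -> : \sum_(i < m) s (c i) * g i = s (x * r).
  by rewrite rE rmorph_sum; apply: eq_bigr => i _; rewrite rmorphM /= (Ss _ (Sg i)).
by rewrite rmorphM sx0 mul0r add0r.
Qed.

(** Once x = 0 is substituted in the syzygies of [J + (x v)], the quotient by them has both [J] and
    R/(J : v) as retracts, so its bound passes to each. *)
Lemma qdim_le_principal_inv p J v : extended_ideal J -> s v = v ->
  qdim_le p.+1 (add_principal J (x * v)) ->
  qdim_le p.+1 J /\ qdim_le p (colon J v).
Proof.
move=> [JJ Js Jx] sv Ip; have [xreg sx0 hor] := xs.
pose C := {c : R^o | J c /\ s c = c}.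
have [F [b bF]] := free_exists R (option C).
have [u [uD uZ ub]] : exists u : F -> F,
    [/\ {morph u : y z / y + z}, forall a z, u (a *: z) = s a *: u z
      & forall i, u (b i) = b i] by case: bF => + _ _; apply.
have us : slinear s u by [].
have uu z : u (u z) = u z.
  have [? [_ ->]] // := xexpansion_coef0 xs us (free_xexpansion xs z bF us ub).
(* [Some] indexes [s]-fixed elements of [J] and [None] the generator [x * v]. [D] is the full cover,
   [d] drops [x * v], [c] reads its coefficient, [a] projects onto the other basis vectors. *)
have [d dE] := free_lift (fun i : option C => oapp sval (0 : R^o) i) bF.
have [D DE] := free_lift (fun i : option C => oapp sval (x * v : R^o) i) bF.
have [c cE] := free_lift (fun i : option C => oapp (fun=> 0) (1 : R^o) i) bF.
have [a aE] := free_lift (fun i : option C => oapp (fun j => b (Some j)) 0 i) bF.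
have ind := let: And3 _ h _ := bF in h.
have dJ z : J (d z).
  apply: (ind (fun z => J (d z))) => [|e i y Jy]; first by rewrite linear0; case: JJ.
  rewrite linearP; apply: JJ.2 => //; rewrite dE.
  by case: i => [[? []]|] //=; case: JJ.
(* The [s]-fixed elements generate [J]: the constant coefficient of an element of [J] is its image
   under [s], and saturation puts the rest, divided by [x], in [J]. *)
have dS f : J f -> exists z, d z = f.
  have := hor f; elim=> {f} [_|f f' sf _ IH Jf].
    by exists 0; rewrite linear0.
  have Jsf : J f.
    by have := Js _ Jf; rewrite rmorphD rmorphM sx0 mul0r addr0 sf.
  have [z zE] : exists z, d z = f'.
    by apply/IH/Jx; rewrite -[x * f'](addKr f); apply: submoduleD => //; apply: submoduleN.
  exists (b (Some (exist _ f (conj Jsf sf))) + x *: z).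
  by rewrite linearD linearZ /= dE zE.
have DdE z : D z = d z + c z * (x * v).
  apply: (ind (fun z => D z = d z + c z * (x * v))) => [|e i y IH].
    by rewrite !linear0 mul0r addr0.
  rewrite !linearP IH DE dE cE /= mulrDl addrACA; congr (_ + _).
  rewrite -scalerAl -scalerDr; congr (_ *: _).
  by case: i => [j|] /=; rewrite ?mul0r ?addr0 ?mul1r ?add0r.
have da z : d (a z) = d z.
  apply: (ind (fun z => d (a z) = d z)) => [|e i y IH]; first by rewrite !linear0.
  by rewrite !linearP IH aE dE; case: i => [j|] /=; rewrite ?dE ?linear0.
have ca z : c (a z) = 0.
  apply: (ind (fun z => c (a z) = 0)) => [|e i y IH]; first by rewrite !linear0.
  by rewrite !linearP IH aE; case: i => [j|] /=; rewrite ?cE ?linear0 ?scaler0 addr0.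
have au z : a (u z) = u (a z).
  apply: (free_ext (f := a \o u) (g := u \o a) (s := s) bF)
    => [y y'|y y'|e y|e y|i] /=; rewrite ?uD ?uZ ?linearD ?linearZ ?uD ?uZ ?ub //.
  by rewrite aE; case: i => [j|] /=; rewrite ?ub // (slinear0 us).
have du z : d (u z) = s (d z).
  apply: (free_ext (M := R^o) (f := d \o u) (g := s \o d) (s := s) bF)
    => [y y'|y y'|e y|e y|i] /=;
    rewrite ?uD ?uZ ?linearD ?linearZ ?rmorphD ?rmorphM ?ub //.
  by rewrite dE; case: i => [[? []]|] //=; rewrite rmorph0.
have cu z : c (u z) = s (c z).
  apply: (free_ext (M := R^o) (f := c \o u) (g := s \o c) (s := s) bF)
    => [y y'|y y'|e y|e y|i] /=;
    rewrite ?uD ?uZ ?linearD ?linearZ ?rmorphD ?rmorphM ?ub //.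
  by rewrite cE; case: i => [j|] //=; rewrite ?rmorph0 ?rmorph1.
have Dp : qdim_le p (fun z => D z = 0).
  apply: qdim_le_cover Ip; first exact: free_projective bF.
  move=> f; split=> [[g [r [/dS[z <-] ->]]]|[z <-]]; last first.
    by exists (d z), (c z); rewrite DdE.
  exists (a z + r *: b None); rewrite DdE !linearD !linearZ /= ca cE dE da.
  by rewrite scaler0 addr0 add0r [r *: _]mulr1.
have := qdim_le_base_change xs bF us ub (submodule_ker D) _ Dp.
set T := submod_span _ => Tp.
have {}Tp : qdim_le p T.
  apply: Tp => z; rewrite linearZ /= => xDz.
  by apply: xreg; rewrite mulr0.
have TT : submodule T by apply: submodule_submod_span.
have Tu z : D z = 0 -> T (u z) by move=> Dz T' _; apply; exists z.
have Tmin (K : F -> Prop) : submodule K -> (forall z, D z = 0 -> K (u z)) ->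
    forall z, T z -> K z.
  by move=> KK DK z; move/(_ K KK); apply=> _ [y /DK Ky <-].
split.
  exists F, d; split; first exact: free_projective bF.
    by move=> f; split=> [/dS //|[z <-]].
  apply: (qdim_le_retract (al := a) (be := idfun)) Tp.
  - exact: free_projective bF.
  - exact: submodule_ker.
  (* Coefficient by coefficient again: if [f] is fixed by [u] and [d f = 0], then [a f] is fixed by
     [u] and lies in the kernel of [D]. *)
  - move=> z; elim: (free_xexpansion xs z bF us ub) => {z} [_|f z uf _ IH].
      by rewrite linear0; case: TT.
    rewrite linearD linearZ /= => fz.
    have df : d f = 0.
      have : s (d (f + x *: z)) = 0 by rewrite linearD linearZ /= fz rmorph0.
      by rewrite -du uD uZ sx0 scale0r addr0 uf.
    rewrite linearD linearZ; apply: (submoduleD TT); last first.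
      apply: (submoduleZ _ TT); apply: IH; apply: xreg.
      by rewrite mulr0 -[RHS]fz df add0r.
    by rewrite -uf au; apply: Tu; rewrite DdE da df ca mul0r addr0.
  - apply: Tmin; first exact: submodule_ker.
    move=> z; rewrite DdE /= du => /(congr1 s).
    by rewrite rmorphD !rmorphM sx0 mul0r mulr0 addr0 rmorph0.
  - by move=> z; rewrite linearB /= da subrr.
have L (e r r' : R^o) : (e *: r + r') *: b None = e *: (r *: b None) + r' *: b None.
  by rewrite scalerDl scalerA.
have cJ : submodule (colon J v).
  split=> [|e r r' Jr Jr']; first by rewrite /colon mul0r; case: JJ.
  by rewrite /colon mulrDl -mulrA; apply: JJ.2.
apply: (qdim_le_retract (al := mklin L) (be := c)) Tp => //.
- exact: projective_unit.
- move=> r; have := hor r; elim=> {r} [_|f r sf _ IH Jfr].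
    by rewrite linear0; case: TT.
  have Jf : J (f * v).
    have := Js _ Jfr; rewrite !rmorphM rmorphD rmorphM sx0 mul0r addr0.
    by rewrite sf sv.
  rewrite linearD linearZ; apply: (submoduleD TT); last first.
    apply: (submoduleZ _ TT); apply: IH; apply: Jx.
    have -> : x * (r * v) = (f + x * r) * v - f * v.
      by rewrite mulrDl addrC addKr mulrA.
    exact: submoduleB.
  (* As [d z = f * v], the element [f *: b None - x *: a z] is killed by [D], while [u] sends it to
     [f *: b None]. *)
  have [z zE] := dS _ Jf.
  have -> : mklin L f = u (f *: b None - x *: a z).
    by rewrite (slinearB _ _ us) !uZ sf sx0 scale0r subr0 ub.
  apply: Tu; rewrite DdE !linearB !linearZ /= dE cE ca da zE scaler0.
  rewrite oppr0 scaler0 addr0 add0r /= [f *: 1]mulr1 [x *: _]mulrN mulrCA.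
  exact: addNr.
- apply: Tmin; first by split; [rewrite linear0; case: cJ|move=> e y y' Jy Jy';
    rewrite linearP; apply: cJ.2].
  (* [D z = 0] puts x (c z) v in [J]; saturation removes [x], and [s] turns [c z] into [c (u z)]. *)
  move=> z; rewrite DdE cu /colon -{2}sv -rmorphM => Dz; apply/Js/Jx.
  rewrite mulrCA -[_ * _](addKr (d z)) Dz addr0; exact: submoduleN.
- move=> r; rewrite linearZ /= cE [_ *: 1]mulr1 subrr; by case: cJ.
Qed.

End Ideals.

(** * Comparison with projective resolutions *)

Section KernelModule.
Context (R : comNzRingType) (M N : lmodType R) (f : {linear M -> N}).

Definition in_kernel : {pred M} := fun x => f x == 0.

Lemma in_kernel_closed : submod_closed in_kernel.
Proof.
split=> [|a x y]; rewrite !unfold_in; first by rewrite linear0.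
by move=> /eqP fx /eqP fy; rewrite linearP fx fy scaler0 addr0.
Qed.

HB.instance Definition _ := GRing.isSubmodClosed.Build R M in_kernel
  in_kernel_closed.

Definition kernel_module := {x : M | x \in in_kernel}.

HB.instance Definition _ := SubChoice.on kernel_module.
HB.instance Definition _ :=
  GRing.SubChoice_isSubLmodule.Build R M in_kernel kernel_module in_kernel_closed.

Lemma kernel_exists : exists (K : lmodType R) (i : {linear K -> M}),
  injective i /\ forall x, f x = 0 <-> exists y, i y = x.
Proof.
exists (kernel_module : lmodType R), (val : {linear kernel_module -> M}).
split; first exact: val_inj.
move=> x; split=> [/eqP fx|[[y fy] <-]]; last exact/eqP.
by exists (exist _ x fx).
Qed.

End KernelModule.

Section Resolutions.
Context (R : comNzRingType).
Implicit Types F P Q : lmodType R.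

Lemma qdim_le_resolution m F (P : nat -> lmodType R)
    (d : forall i, {linear P i.+1 -> P i}) (eps : {linear P 0%N -> F}) :
  (forall i, projective (P i)) -> (forall i, (m < i)%N -> forall x : P i, x = 0) ->
  (forall x, eps x = 0 <-> exists y, d 0%N y = x) ->
  (forall i x, d i x = 0 <-> exists y, d i.+1 y = x) ->
  qdim_le m (fun x => eps x = 0).
Proof.
elim: m F P d eps => [|m IH] F P d eps Pproj P0 exact0 exactS.
  exists \0; split=> [x|x /exact0[y <-]]; first exact: linear0.
  by rewrite (P0 1%N _ y) // linear0.
exists (P 1%N), (d 0%N); split=> //.
by apply: (IH _ (fun i => P i.+1) (fun i => d i.+1)) => // i mi; apply: P0.
Qed.

Lemma zero_module_exists : exists Z : lmodType R, forall x : Z, x = 0.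
Proof.
have [Z [i [i_inj iE]]] := kernel_exists (idfun : {linear R^o -> R^o}).
by exists Z => x; apply: i_inj; rewrite linear0; apply/iE; exists x.
Qed.

Definition prepend P (P' : nat -> lmodType R) (i : nat) : lmodType R :=
  if i is j.+1 then P' j else P.

Definition prepend_map P (P' : nat -> lmodType R)
    (d' : forall i, {linear P' i.+1 -> P' i}) (f : {linear P' 0%N -> P}) i :
    {linear prepend P P' i.+1 -> prepend P P' i} :=
  match i with 0%N => f | j.+1 => d' j end.

Lemma resolution_exists m F (S : F -> Prop) : qdim_le m.+1 S ->
  exists (P : nat -> lmodType R) (d : forall i, {linear P i.+1 -> P i})
         (eps : {linear P 0%N -> F}),
    [/\ forall i, projective (P i),
        forall i, (m < i)%N -> forall x : P i, x = 0,
        forall f, S f <-> exists x, eps x = f,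
        forall x, eps x = 0 <-> exists y, d 0%N y = x
      & forall i x, d i x = 0 <-> exists y, d i.+1 y = x].
Proof.
elim: m F S => [|m IH] F S.
  move=> [P [d [Pproj dS [e [de eid]]]]].
  have [Z Z0] := zero_module_exists.
  (* The kernel of [d] is the summand e(P), so [S] is isomorphic to the complementary summand ker e,
     which is projective and is the whole resolution. *)
  have [K [i [i_inj iE]]] := kernel_exists e.
  have ede x : e (x - e x) = 0 by rewrite linearB /= (eid (e x)) ?subrr.
  have [h hE] := choice (fun x => (iE (x - e x)).1 (ede x)).
  have L a x y : h (a *: x + y) = a *: h x + h y.
    apply: i_inj; rewrite linearP !hE linearP /=.
    by rewrite scalerBr opprD addrACA.
  have hi y : h (i y) = y.
    by apply: i_inj; rewrite hE (_ : e (i y) = 0) ?subr0 //; apply/iE; exists y.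
  exists (prepend K (fun=> Z)).
  exists (@prepend_map K (fun=> Z) (fun=> \0) \0), (d \o i).
  split=> //.
  - case=> [|j]; first exact: (projective_retract (i := i) (r := mklin L)).
    move=> M N f g fS; exists \0 => x; rewrite (Z0 x) !linear0 //.
  - by case.
  - move=> f; rewrite dS; split=> [[y <-]|[y <-]]; last by exists (i y).
    by exists (h y); rewrite /= hE linearB (de y) subr0.
  - move=> x; split=> [/= dix|[y <-] /=]; last by rewrite !linear0.
    exists (0 : Z) => /=; apply: i_inj; rewrite linear0 -(eid _ dix).
    by apply/esym/iE; exists x.
  - by case=> [|j] x; split=> _ //; exists (0 : Z); exact: esym (Z0 x).
move=> [P [d [Pproj dS /IH[P' [d' [eps' [P'proj P'0 eps'E exact0 exactS]]]]]]].
exists (prepend P P'), (prepend_map d' eps'), d.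
by split=> //; case.
Qed.

End Resolutions.

(** The delicate case is [m = 0], where projectivity of R/I must force I = 0: [e 1] is an idempotent
    of a domain, and it is not 1 since [I] is proper. *)
Lemma projective_resolution_uptoP (R : idomainType) (I : R^o -> Prop) m :
  submodule I -> ~ I 1 -> projective_resolution_upto I m <-> qdim_le m I.
Proof.
move=> SI I1; case: m => [|m]; last first.
  split=> [[P [d [eps [Pproj P0 epsE exact0 exactS]]]]|/resolution_exists //].
  by exists (P 0%N), eps; split=> //; apply: qdim_le_resolution exactS.
split=> [[P [d [eps [Pproj P0 epsE exact0 exactS]]]]|[e [eI eid]]].
  exists \0; split=> [x|x /epsE[y <-]]; first by case: SI.
  by rewrite (P0 0%N isT y) linear0.
have eE r : e r = r * e 1 by rewrite -[r in LHS]mulr1; exact: linearZ.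
have e0 : e 1 = 0.
  apply/eqP; have : e 1 * (e 1 - 1) == 0.
    by rewrite mulrBr mulr1 -eE eid ?subrr.
  rewrite mulf_eq0 subr_eq0 => /orP[//|/eqP e1].
  by case: I1; rewrite -e1.
have [Z Z0] := zero_module_exists R.
exists (fun=> Z), (fun=> \0), \0; split=> //.
- by move=> i M N f g fS; exists \0 => x; rewrite (Z0 x) !linear0.
- move=> f; split=> [If|[x <-]]; last by case: SI.
  by exists 0; rewrite -(eid f) // eE e0 mulr0.
- by move=> x; split=> _ //; exists 0; rewrite linear0 [RHS]Z0.
- by move=> i x; split=> _; rewrite ?(Z0 x) ?linear0 //; exists 0; rewrite linear0.
Qed.

(** * Square-free monomial ideals *)

Section SquareFreeMonomialIdeals.
Context (k : fieldType) (n : nat).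
Local Notation R := {mpoly k[n]}.
Implicit Types (A B : {set 'I_n}) (C : {set 'I_n} -> Prop) (f g : R) (v : 'I_n).

Definition eval0 v : R -> R :=
  comp_mpoly [tuple (if i == v then 0 else 'X_i : R) | i < n].

HB.instance Definition _ v := GRing.RMorphism.on (eval0 v).

Lemma eval0X v m : eval0 v 'X_[m] = if m v == 0%N then 'X_[m] else 0.
Proof.
rewrite /eval0 comp_mpolyX; case: eqP => [mv|/eqP mv].
  rewrite [RHS]mpolyXE_id; apply: eq_bigr => i _; rewrite tnth_mktuple.
  by case: eqP => // ->; rewrite mv !expr0.
by rewrite (bigD1 v) //= tnth_mktuple eqxx expr0n (negbTE mv) mul0r.
Qed.

Lemma eval0Z v c f : eval0 v (c *: f) = c *: eval0 v f.
Proof. exact: linearZ. Qed.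

Lemma polynomial_in_var v : polynomial_in ('X_v : R) (eval0 v : {rmorphism R -> R}).
Proof.
have X0 : eval0 v 'X_v = 0 by rewrite eval0X mnm1E eqxx.
split=> // [|r].
  apply/lregP/eqP => /(congr1 (mcoeff U_(v))); rewrite mcoeff0 mcoeffX eqxx.
  by move/eqP; rewrite oner_eq0.
have sD : {morph (eval0 v : R^o -> R^o) : y z / y + z} by move=> y z; rewrite rmorphD.
elim/mpolyind: r => [|c m p _ _ IH]; first exact: XExpansion0.
apply: xexpansionD => // {p IH}.
move mv: (m v) => j; elim: j m mv => [|j IH] m mv.
  have fixX : eval0 v (c *: 'X_[m]) = c *: 'X_[m] by rewrite eval0Z eval0X mv.
  rewrite -[_ *: _]addr0 -[0 in X in _ + X](mulr0 ('X_v : R)).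
  by apply: (@XExpansionS _ _ R^o); [exact: fixX|exact: XExpansion0].
have vm : (U_(v) <= m)%MM by rewrite lep1mP mv.
rewrite -(submK vm) addmC mpolyXD -[_ *: _]add0r scalerAr.
apply: (@XExpansionS _ _ R^o); first exact: rmorph0.
by apply: IH; rewrite mnmBE mnm1E eqxx mv subn1.
Qed.

Definition mnm_of A : 'X_{1..n} := [multinom (i \in A : nat) | i < n].

Definition sqfree_ideal C : R -> Prop :=
  ideal_generated (fun g => exists2 A, C A & g = 'X_[mnm_of A]).

Lemma mnm_of_le A m : (mnm_of A <= m)%MM <-> forall i, i \in A -> (0 < m i)%N.
Proof.
split=> [/mnm_lepP Am i iA|Am]; first by have := Am i; rewrite mnmE iA.
by apply/mnm_lepP => i; rewrite mnmE; case: (boolP (i \in A)) => // /Am.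
Qed.

(** A polynomial lies in a monomial ideal exactly when each of its monomials does; membership
    becomes a question about index sets. *)
Lemma sqfree_idealP C f : sqfree_ideal C f <->
  forall m, m \in msupp f -> exists2 A, C A & forall i, i \in A -> (0 < m i)%N.
Proof.
have SM : submodule (sqfree_ideal C : R^o -> Prop) by apply: submodule_generated.
split=> [[p [c [g [gC ->]]]] m|Hf].
  move=> /msupp_sum_le/flattenP[s /mapP[i _ ->]].
  have [A CA ->] := gC i; rewrite (perm_mem (msuppMX _ _)) => /mapP[m' _ ->].
  exists A => // j jA; rewrite mnmDE mnmE jA //.
rewrite [f]mpolyE; elim: (msupp f) Hf => [|m s IH] Hf.
  by rewrite big_nil; case: SM.
rewrite big_cons; apply: (submoduleD SM); last first.
  by apply: IH => m' m's; apply: Hf; rewrite inE m's orbT.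
have [|A CA /mnm_of_le Am] := Hf m; first by rewrite inE eqxx.
rewrite -(submK Am) mpolyXD scalerAl.
apply: (submoduleZ (_ *: _ : R) SM).
by apply: generated_gen; exists A.
Qed.

Lemma submodule_sqfree C : submodule (sqfree_ideal C : R^o -> Prop).
Proof. exact: submodule_generated. Qed.

Lemma sqfree_ideal_gen C A : C A -> sqfree_ideal C 'X_[mnm_of A].
Proof. by move=> CA; apply: generated_gen; exists A. Qed.

Lemma sqfree_ideal_sub C C' f :
  (forall A, C A -> exists2 B, C' B & B \subset A) ->
  sqfree_ideal C f -> sqfree_ideal C' f.
Proof.
move=> CC' /sqfree_idealP Cf; apply/sqfree_idealP => m /Cf[A /CC'[B C'B BA] Am].
by exists B => // i /(subsetP BA)/Am.
Qed.

Lemma sqfree_ideal_proper C : (forall A, C A -> A != set0) -> ~ sqfree_ideal C 1.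
Proof.
move=> C0 /sqfree_idealP/(_ 0%MM)[|A /C0/set0Pn[i iA] /(_ i iA)].
  by rewrite msupp1 inE.
by rewrite mnmE.
Qed.

(** The monomial of [A] divides m times that of [B] exactly when the monomial of [A :\: B] divides
    m. *)
Lemma colon_sqfree C B f : colon (sqfree_ideal C) 'X_[mnm_of B] f <->
  sqfree_ideal (fun D => exists2 A, C A & D = A :\: B) f.
Proof.
rewrite /colon; split=> /sqfree_idealP Cf; apply/sqfree_idealP => m mf.
  have [|A CA Am] := Cf (mnm_of B + m)%MM.
    by rewrite (perm_mem (msuppMX _ _)) map_f.
  exists (A :\: B) => [|i]; first by exists A.
  by rewrite inE => /andP[iB /Am]; rewrite mnmDE mnmE (negbTE iB).
move: mf; rewrite (perm_mem (msuppMX _ _)) => /mapP[m' /Cf[_ [A CA ->] Am'] ->].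
exists A => // i iA; rewrite mnmDE mnmE; case: (boolP (i \in B)) => // iB.
by rewrite Am' // inE iB.
Qed.

Lemma add_principal_sqfree C B f :
  add_principal (sqfree_ideal C) 'X_[mnm_of B] f <->
  sqfree_ideal (fun A => C A \/ A = B) f.
Proof.
have [SP minP] := add_principalP 'X_[mnm_of B] (submodule_sqfree C).
split=> [|/(generated_min (J := add_principal (sqfree_ideal C) 'X_[mnm_of B])) ].
  apply: minP; first exact: submodule_sqfree.
    by move=> g; apply: sqfree_ideal_sub => A CA; exists A; [left|].
  by apply: sqfree_ideal_gen; right.
apply=> // _ [A [CA|->] ->].
  by exists 'X_[mnm_of A], 0; rewrite mul0r addr0; split=> //; apply: sqfree_ideal_gen.
by exists 0, 1; rewrite mul1r add0r; split=> //; case: (submodule_sqfree C).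
Qed.

Lemma extended_sqfree C v : (forall A, C A -> v \notin A) ->
  extended_ideal ('X_v : R) (eval0 v : {rmorphism R -> R}) (sqfree_ideal C).
Proof.
move=> Cv; apply: (extended_generated (polynomial_in_var v)) => _ [A /Cv vA ->].
by apply: etrans (eval0X _ _) _; rewrite mnmE (negbTE vA).
Qed.

Lemma mnm_ofU v B : v \notin B -> mnm_of (v |: B) = (U_(v) + mnm_of B)%MM.
Proof.
move=> vB; apply/mnmP => i; rewrite mnmDE mnm1E !mnmE !inE [v == i]eq_sym.
by case: eqP => // ->; rewrite (negbTE vB).
Qed.

(** Adjoining one generator, read on index sets. The colons by [v |: B] and by [B] agree because [v]
    occurs in no generator from [C]. *)
Lemma qdim_le_sqfree_add p C v B :
  (forall A, C A -> v \notin A) -> v \notin B ->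
  qdim_le p.+1 (sqfree_ideal (fun A => C A \/ A = v |: B) : R^o -> Prop) <->
  qdim_le p.+1 (sqfree_ideal C : R^o -> Prop) /\
  qdim_le p (sqfree_ideal (fun D => exists2 A, C A & D = A :\: B) : R^o -> Prop).
Proof.
move=> Cv vB.
have cE := colon_sqfree C B; have aE := add_principal_sqfree C (v |: B).
split=> [Hp|[HC Hc]]; last first.
  apply: (@qdim_le_ext _ _ R^o _ _ aE); apply: qdim_le_add_principal => //.
    exact: submodule_sqfree.
  apply: qdim_le_ext Hc => f; rewrite colon_sqfree; split;
    apply: sqfree_ideal_sub => _ [A CA ->].
    exists (A :\: (v |: B)); first by exists A.
    by rewrite setDS // subsetUr.
  exists (A :\: B); first by exists A.
  apply/subsetP => i; rewrite !inE negb_or => /andP[iB iA].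
  by rewrite iB iA !andbT; apply: contraTneq iA => ->; apply: Cv.
have [] := qdim_le_principal_inv (p := p) (v := 'X_[mnm_of B])
  (polynomial_in_var v) (extended_sqfree Cv).
- by apply: etrans (eval0X _ _) _; rewrite mnmE (negbTE vB).
- by apply: qdim_le_ext Hp => f; rewrite -aE mnm_ofU // mpolyXD.
- by move=> HC Hc; split=> //; apply: qdim_le_ext Hc => f; apply: cE.
Qed.

(** Bound zero would force the ideal to vanish, yet it contains a monomial. *)
Lemma qdim_le0_sqfree C A : (forall B, C B -> B != set0) -> C A ->
  ~ qdim_le 0 (sqfree_ideal C : R^o -> Prop).
Proof.
move=> C0 CA.
move/(projective_resolution_uptoP _ (submodule_sqfree C) (sqfree_ideal_proper C0)).
move=> [P [d [eps [_ P0 epsE _ _]]]].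
have [y] := (epsE 'X_[mnm_of A]).1 (sqfree_ideal_gen CA).
rewrite (P0 0%N isT y) linear0 => /esym/eqP.
by apply/negP; rewrite -msupp_eq0 msuppX.
Qed.

(* The variables of [ys] form a regular sequence modulo the ideal of [C]. *)
Lemma qdim_le_sqfree_vars q C (ys : seq 'I_n) : uniq ys ->
  (forall A, C A -> A != set0) ->
  (forall A y, C A -> y \in ys -> y \notin A) ->
  qdim_le q (sqfree_ideal
    (fun A => C A \/ exists2 y, y \in ys & A = [set y]) : R^o -> Prop) <->
  (size ys <= q)%N /\ qdim_le (q - size ys) (sqfree_ideal C : R^o -> Prop).
Proof.
move=> ys_uniq C0; elim: ys ys_uniq q => [|y ys IH] /=.
  move=> _ q _; rewrite subn0; split=> [Hq|[_ Hq]].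
    split=> //; apply: qdim_le_ext Hq => f; split; apply: sqfree_ideal_sub => A.
      by move=> [CA|[]] //; exists A.
    by move=> CA; exists A; [left|].
  apply: qdim_le_ext Hq => f; split; apply: sqfree_ideal_sub => A.
    by move=> CA; exists A; [left|].
  by move=> [CA|[]] //; exists A.
move=> /andP[yys ys_uniq] q Cys.
pose C' A := C A \/ exists2 y, y \in ys & A = [set y].
have C'0 A : C' A -> A != set0.
  by move=> [/C0 //|[z _ ->]]; apply/set0Pn; exists z; rewrite set11.
have C'y A : C' A -> y \notin A.
  move=> [/Cys->//|[z zys ->]]; first by rewrite mem_head.
  by rewrite inE; apply: contraNneq yys => ->.
(* The variable [y] is adjoined with empty cofactor: the colon by 1 is the ideal itself, so each
   variable costs exactly one. *)
have addE f : sqfree_ideal (fun A => C' A \/ A = y |: set0) f <->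
    sqfree_ideal (fun A => C A \/ exists2 z, z \in y :: ys & A = [set z]) f.
  rewrite setU0; split; apply: sqfree_ideal_sub => A.
    move=> [[CA|[z zys ->]]|->]; first by exists A; [left|].
      by exists [set z] => //; right; exists z; rewrite // inE zys orbT.
    by exists [set y] => //; right; exists y; rewrite // mem_head.
  move=> [CA|[z + ->]]; first by exists A; [left; left|].
  rewrite inE => /predU1P[->|zys]; first by exists [set y]; [right|].
  by exists [set z] => //; left; right; exists z.
have coE f : sqfree_ideal (fun D => exists2 A, C' A & D = A :\: set0) f <->
    sqfree_ideal C' f.
  split; apply: sqfree_ideal_sub => A.
    by move=> [B C'B ->]; exists B; rewrite ?setD0.
  by move=> CA; exists A => //; exists A; rewrite ?setD0.
case: q => [|q].
  split=> [H|[]//]; case: (@qdim_le0_sqfree (fun A => C' A \/ A = y |: set0) [set y]).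
  - by move=> B [/C'0//|->]; apply/set0Pn; exists y; rewrite !inE eqxx.
  - by right; rewrite setU0.
  - by apply: qdim_le_ext H => f; rewrite addE.
rewrite ltnS subSS -IH //; last first.
  by move=> A z CA zys; apply: Cys; rewrite // inE zys orbT.
have y0 : y \notin set0 by rewrite inE.
have key := qdim_le_sqfree_add q C'y y0.
split=> [H|H].
  have /key[_] : qdim_le q.+1
      (sqfree_ideal (fun A => C' A \/ A = y |: set0) : R^o -> Prop).
    by apply: qdim_le_ext H => f; rewrite addE.
  by apply: qdim_le_ext => f; apply: coE.
apply: (@qdim_le_ext _ _ R^o _ _ addE); apply/key; split.
  by apply: qdim_leS H; apply: projective_unit.
by apply: qdim_le_ext H => f; rewrite coE.
Qed.

End SquareFreeMonomialIdeals.

(** * Directed paths in rooted trees *)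

Section RootedTrees.
Context (T : finType) (e : rel T) (r : T) (treeE : tree e).
Local Notation G := (rooted_tree e r).

(** The depth is the length of the unique path from the root. Along an arc, the path to [v] is the
    path to [u] followed by [v], which also determines the parent. *)
Lemma rooted_tree_depth : exists h : T -> nat,
  (forall u v, arcs G u v -> h v = (h u).+1) /\
  (forall u u' v, arcs G u v -> arcs G u' v -> u = u').
Proof.
have [[_ e_irr] e_path] := treeE.
have path0 q : uniq (r :: q) -> last r q = r -> q = [::].
  case/lastP: q => // q z; rewrite last_rcons => /[swap] ->.
  by rewrite /= mem_rcons mem_head.
have pP v : exists p : seq T, [/\ path e r p, uniq (r :: p), last r p = v
    & forall q, path e r q -> uniq (r :: q) -> last r q = v -> q = p].
  have [<-|rv] := eqVneq r v; first by exists [::]; split=> // q _; apply: path0.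
  have [p [[pe pu pl] pU]] := e_path r v rv.
  by exists p; split=> // q qe qu ql; apply/esym/pU.
have [p {}pP] := choice pP.
have arcP u v : arcs G u v -> p v = rcons (p u) v.
  case/andP=> euv /connectP[q0 q0e q0u].
  have [_ _ _ pvU] := pP v; have [_ _ _ puU] := pP u.
  move: q0u; case/shortenP: q0e => q qe qu _ uE.
  (* The arc condition supplies a path to [u] whose steps avoid [v]; when it is empty, irreflexivity
     separates the root from [v]. *)
  have q_v : v \notin r :: q.
    case: q qe {qu} uE => [_ /= ur|z q qe _].
      by rewrite inE -ur; apply: contraTneq euv => ->; rewrite e_irr.
    rewrite inE negb_or; case/andP: (qe) => /and3P[_ rv _] _.
    rewrite eq_sym rv /=; elim: {rv} (z :: q) r qe => //= y s IH x.
    by case/andP=> /and3P[_ _ yv] /IH; rewrite inE negb_or eq_sym yv.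
  have {}qe : path e r q by apply: sub_path qe => x y /and3P[].
  rewrite -(puU q) //; apply/esym/pvU; last by rewrite last_rcons.
    by rewrite rcons_path qe -uE.
  by rewrite -rcons_cons rcons_uniq q_v qu.
exists (fun v => size (p v)); split=> [u v /arcP ->|u u' v /arcP uE /arcP].
  by rewrite size_rcons.
rewrite uE => /rcons_inj[pE]; have [_ _ <- _] := pP u; have [_ _ <- _] := pP u'.
by rewrite pE.
Qed.

Lemma rooted_tree_uniq s : dipath G s -> uniq s.
Proof.
have [h [hS _]] := rooted_tree_depth; case/andP=> _ ss.
apply: (@sorted_uniq _ (relpre h ltn)) => [y x z|x|]; rewrite /= ?ltnn //.
  exact: ltn_trans.
by apply: sub_sorted ss => u v /hS /= ->.
Qed.

(** Parents are unique, so a path can be read backwards from its end. *)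
Lemma rooted_tree_rcons_inj s s' x : dipath G (rcons s x) ->
  dipath G (rcons s' x) -> size s = size s' -> s = s'.
Proof.
have [_ [_ parent]] := rooted_tree_depth; case/andP=> _ + /andP[_].
elim/last_ind: s x s' => [|s y IH] x s' xs xs'; first by move/esym/size0nil.
case/lastP: s' xs' => [|s' y'] xs'; first by rewrite size_rcons.
move: xs xs'; rewrite -!cats1 -!catA /= => xs xs'.
have arc z w : sorted (arcs G) (z ++ [:: w; x]) -> arcs G w x.
  by case: z => [|c z] /=; [case/andP|rewrite cat_path /= => /and4P[]].
have pre z w : sorted (arcs G) (z ++ [:: w; x]) -> sorted (arcs G) (rcons z w).
  by rewrite -[[:: w; x]]/([:: w] ++ [:: x]) catA (cats1 z w) => /cat_sorted2[].
have yE : y = y' := parent _ _ _ (arc _ _ xs) (arc _ _ xs').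
rewrite yE in xs *.
by rewrite !size_cat !addn1 => -[/(IH _ _ (pre _ _ xs) (pre _ _ xs')) ->].
Qed.

(** The only neighbour of the leaf is its parent, so a path through the leaf must stop there; end
    and length then determine it. *)
Lemma rooted_tree_leaf s s' : (1 < size s)%N -> dipath G s -> dipath G s' ->
  size s' = size s -> leaf e (last r s) -> last r s \in s' -> s' = s.
Proof.
have [[e_sym _] _] := treeE; have [h [hS _]] := rooted_tree_depth.
case/lastP: s => // s x; rewrite last_rcons size_rcons.
case/lastP: s => // s u _ Gs + + /eqP/cards1P[w lw].
have uw y : e x y -> y = w by move=> exy; apply/set1P; rewrite -lw inE.
have ux : arcs G u x.
  case/andP: Gs => _; case: s => [|c s] /=; first by case/andP.
  by rewrite !rcons_path last_rcons => /andP[].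
move=> + + xs'; case/splitPr: xs' => s1 [|v s2] Gs' sizeE; last first.
  have xv : arcs G x v.
    case/andP: Gs' => _; case: s1 {sizeE} => [|c s1] /=; first by case/andP.
    by rewrite cat_path /= => /and4P[].
  have uv : u = v.
    apply: etrans (uw u _) (esym (uw v _)); last by case/andP: xv.
    by rewrite e_sym; case/andP: ux.
  (* A successor [v] would equal the parent [u], whose depth would exceed itself by two. *)
  have := hS _ _ xv; rewrite -uv (hS _ _ ux) => /eqP.
  by rewrite ltn_eqF // ltnS leqnSn.
rewrite cats1 in Gs' sizeE *; rewrite (rooted_tree_rcons_inj Gs' Gs) //.
by move: sizeE; rewrite !size_rcons => -[].
Qed.

End RootedTrees.

(** * Vertex sets of paths and facets of the path complex *)

Section PathComplex.
Context (T : finType) (t : nat).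
Implicit Types (D : digraph T) (A B F H : {set T}).

Definition path_set D A : Prop :=
  exists s : t.-tuple T, dipath D s /\ A = [set x in s].

Lemma dipath_delete D S s :
  dipath (delete D S) s = dipath D s && all [predC S] s.
Proof.
rewrite /dipath /=; have -> : all (mem (verts D :\: S)) s =
    all (mem (verts D)) s && all [predC S] s.
  rewrite -all_predI; apply: eq_all => x; by rewrite /= inE andbC.
rewrite -!andbA; case: (all _ s) => //=.
case: (boolP (all [predC S] s)) => [sS|]; rewrite ?andbF // andbT.
apply: eq_in_sorted sS => x y xS yS /=.
have [xS' yS'] : x \notin S /\ y \notin S by [].
by rewrite xS' yS' !andbT.
Qed.

(** All path sets have [t] elements, so none is properly contained in another. *)
Lemma path_facetsP D F : (forall s, dipath D s -> uniq s) ->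
  F \in facets (path_complex D t) <-> path_set D F.
Proof.
move=> Du; rewrite inE; split=> [/maxsetP[]|[s [Ds ->]]].
  rewrite /= inE => /existsP[s /andP[Ds Fs]] Fmax; exists s; split=> //.
  apply/esym/Fmax => //; rewrite /= inE; apply/existsP; exists s.
  by rewrite Ds subxx.
apply/maxsetP; split=> [|B].
  by rewrite /= inE; apply/existsP; exists s; rewrite Ds subxx.
rewrite /= inE => /existsP[s' /andP[Ds' Bs']] sB; apply/eqP.
rewrite eq_sym eqEcard sB /= (leq_trans (subset_leq_card Bs')) //.
by rewrite !cardsE !(card_uniqP _) ?Du // !size_tuple.
Qed.

Lemma path_set_card D A : (forall s, dipath D s -> uniq s) ->
  path_set D A -> #|A| = t.
Proof. by move=> Du [s [Ds ->]]; rewrite cardsE (card_uniqP _) ?Du ?size_tuple. Qed.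

Lemma path_set_delete D S A :
  path_set (delete D S) A <-> path_set D A /\ [disjoint A & S].
Proof.
have allE (s : seq T) : all [predC S] s = [disjoint [set x in s] & S].
  apply/allP/pred0P => [sS x /=|sS x xs].
    by rewrite inE; case: (boolP (x \in s)) => // /sS /negbTE.
  by have := sS x; rewrite /= !inE xs /= => ->.
split=> [[s []]|[[s [Ds ->]] sS]].
  by rewrite dipath_delete allE => /andP[Ds sS] ->; split=> //; exists s.
by exists s; rewrite dipath_delete allE Ds.
Qed.

End PathComplex.

(** * Proper chains of minimal length *)

Section ProperChains.
Context (T : finType) (t : nat) (F : {set T}).
Implicit Types (A B : {set T}) (p : seq {set T}).

Local Notation adjacent := [rel A B : {set T} | #|A :&: B| == #|B|.-1].

Lemma adjacent_diff A B : (0 < #|B|)%N -> adjacent A B -> #|B :\: A| = 1%N.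
Proof.
move=> B0 /= /eqP AB.
by rewrite cardsD setIC AB -[in X in (X - _)%N](prednK B0) subSnn.
Qed.

Lemma adjacent_meet A B : (0 < #|B|)%N -> adjacent A B ->
  (#|B :&: F| <= #|A :&: F|.+1)%N.
Proof.
move=> B0 /(adjacent_diff B0) BA; rewrite -addn1 -BA.
apply: leq_trans (leq_card_setU _ _); apply/subset_leq_card/subsetP => x.
by rewrite !inE => /andP[-> ->]; rewrite !andbT orbN.
Qed.

(** Each step gains at most one element of [F], and all [t] must be reached. *)
Lemma proper_path_meet A p : (0 < t)%N ->
  {in A :: p, forall B, #|B| = t} -> path adjacent A p -> last A p = F ->
  (t <= size p + #|A :&: F|)%N.
Proof.
move=> t0; elim: p A => [|B p IH] A cA /=.
  by move=> _ <-; rewrite setIid cA ?mem_head.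
case/andP=> AB Bp lp; have cB : #|B| = t by apply: cA; rewrite !inE eqxx orbT.
apply: leq_trans (IH B _ Bp lp) _ => [C Cp|]; first by apply: cA; rewrite inE Cp orbT.
by rewrite addSnnS leq_add2l; apply: adjacent_meet; rewrite ?cB.
Qed.

(* In a chain of length t - |A n F| from A to F, every step adds an element of
   F, so that no element outside of F is ever added. *)
Lemma proper_path_penultimate A p : (0 < t)%N ->
  {in A :: p, forall B, #|B| = t} -> path adjacent A p -> last A p = F ->
  (size p + #|A :&: F| <= t)%N -> A != F ->
  exists B, [/\ B \in A :: p, #|B :&: F| = t.-1 & B :\: F \subset A].
Proof.
move=> t0; elim: p A => [|B p IH] A cA /=; first by move=> _ ->; rewrite eqxx.
case/andP=> AB Bp lp sz AF; have cB : #|B| = t by apply: cA; rewrite !inE eqxx orbT.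
have cBp : {in B :: p, forall C : {set T}, #|C| = t}.
  by move=> C Cp; apply: cA; rewrite inE Cp orbT.
have [BF|BF] := eqVneq B F.
  exists A; rewrite mem_head subsetDl; split=> //.
  by move: AB; rewrite /= BF => /eqP ->; rewrite -BF cB.
have BA1 := adjacent_diff (etrans (congr1 (leq 1) cB) t0 : (0 < #|B|)%N) AB.
have BAF : B :\: A \subset F.
  (* If the new element [b] were outside [F], this step would gain nothing and the remaining chain
     would be too short to reach [F]. *)
  have /eqP/cards1P[b bE] := BA1; rewrite bE sub1set; apply/negPn/negP => bF.
  have : B :&: F \subset A :&: F.
    apply/subsetP => x; rewrite !inE => /andP[xB xF]; rewrite xF andbT.
    apply/negPn/negP => xA; have : x \in B :\: A by rewrite inE xA.
    by rewrite bE => /set1P xb; rewrite -xb xF in bF.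
  move/subset_leq_card; rewrite -(leq_add2l (size p)) => leBA.
  have := leq_trans sz (leq_trans (proper_path_meet t0 cBp Bp lp) leBA).
  by rewrite addSn ltnn.
have [|C [Cp CF CB]] := IH B cBp Bp lp _ BF.
  apply: leq_trans sz; rewrite addSnnS leq_add2l.
  by apply: adjacent_meet; rewrite ?cB.
exists C; split=> //; first by rewrite inE Cp orbT.
apply/subsetP => x xC; have xB := subsetP CB x xC.
apply/negPn/negP => xA; have /(subsetP BAF) : x \in B :\: A by rewrite inE xA.
by move: xC; rewrite inE => /andP[/negP].
Qed.

End ProperChains.

(** * Least values: distances and projective dimensions *)

Lemma leastP P :
  (exists m, [/\ least P = Some m, P m & forall j, P j -> (m <= j)%N]) \/
  least P = None /\ forall j, ~ P j.
Proof.
rewrite /least; case: pselect => [exP|nP]; last first.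
  by right; split=> // j Pj; apply: nP; exists j; apply/asboolP.
left; case: ex_minnP => m /asboolP Pm mmin; exists m; split=> // j /asboolP.
exact: mmin.
Qed.

(** Proper connectedness provides a chain of minimal length t - |A n F|; the facet preceding [F] in
    it will supply an element of [Y] lying in [A]. *)
Lemma properly_connected_penultimate (T : finType) (D : {set {set T}}) t A F :
  (0 < t)%N -> (forall B, B \in facets D -> #|B| = t) -> properly_connected D ->
  A \in facets D -> F \in facets D -> A :&: F != set0 -> A != F ->
  exists B, [/\ B \in facets D, #|B :&: F| = t.-1 & B :\: F \subset A].
Proof.
move=> t0 cD [_ Dc] AD FD AF0 AF; have := Dc A F AD FD AF0; rewrite /dist.
set P := fun _ => _; case: (leastP P) => [[m [-> Pm _]] [mE]|[-> //]].
have [p [/andP[/andP[/and3P[pD _ _] ps] /eqP pl] _] szp] := Pm.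
have [||B [Bp BF BA]] := @proper_path_penultimate T t F A p t0 _ ps pl _ AF.
- by move=> B Bp; apply/cD/(allP pD).
- by rewrite szp mE subnK ?subset_leq_card ?subsetIl // cD.
by exists B; split=> //; apply: (allP pD).
Qed.

(** An equivalence for all bounds [m] becomes an equality of least bounds, since upward closure
    makes the maximum attained. The theorem takes [c] to be a + 1. *)
Lemma pd_max_shift (R : comNzRingType) (I J K : R -> Prop) c :
  (forall m, projective_resolution_upto I m <->
     projective_resolution_upto J m /\
     (c <= m)%N /\ projective_resolution_upto K (m - c)) ->
  (forall L m j, L = J \/ L = K -> (m <= j)%N ->
     projective_resolution_upto L m -> projective_resolution_upto L j) ->
  pd I = maxe (pd J) (pd K + c%:Z%:E)%E.
Proof.
move=> IE up; rewrite /pd.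
case: (leastP (projective_resolution_upto J)) => [[j [-> Jj minJ]]|[-> Jn]]; last first.
  rewrite maxye;
  case: (leastP (projective_resolution_upto I)) => [[i []]|[-> //]].
  by move=> _ /IE[/Jn].
case: (leastP (projective_resolution_upto K)) => [[l [-> Kl minK]]|[-> Kn]]; last first.
  rewrite /= maxey;
  case: (leastP (projective_resolution_upto I)) => [[i []]|[-> //]].
  by move=> _ /IE[_ [_ /Kn]].
have Imax : projective_resolution_upto I (maxn j (l + c)).
  apply/IE; split; first by apply: (up J) Jj; [left|rewrite leq_maxl].
  split; first by rewrite (leq_trans _ (leq_maxr _ _)) // leq_addl.
  apply: (up K) Kl; first by right.
  by rewrite -[X in (X <= _)%N](addnK c) leq_sub2r // leq_maxr.
case: (leastP (projective_resolution_upto I)) => [[i [-> Ii minI]]|[_ /(_ _ Imax)//]].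
have -> : i = maxn j (l + c).
  apply/eqP; rewrite eqn_leq minI //= geq_max.
  have /IE[/minJ-> [ci /minK li]] := Ii.
  by rewrite -(subnK ci) leq_add2r.
rewrite -EFinD -EFin_max; congr (_%:E).
rewrite addrAC -PoszD -Num.Theory.addr_maxl; congr (_ + _).
by rewrite /Order.max /= ltz_nat; case: ltnP.
Qed.

(** * Path ideals of rooted trees *)

Section PathIdeals.
Context (k : fieldType) (n t : nat).
Local Notation R := {mpoly k[n]}.
Local Notation sq C := (sqfree_ideal (C : {set 'I_n} -> Prop) : R^o -> Prop).

Lemma path_idealE (D : digraph 'I_n) : (forall s, dipath D s -> uniq s) ->
  path_ideal k D t = sqfree_ideal (path_set t D).
Proof.
move=> Du; have prodE (s : t.-tuple 'I_n) : dipath D s ->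
    \prod_(i <- s) 'X_i = 'X_[mnm_of [set x in s]] :> R.
  move=> Ds; rewrite mpolyXE_id [RHS](bigID (mem s)) /= [X in _ * X]big1 ?mulr1.
    rewrite big_uniq ?Du //=; apply: eq_bigr => i si.
    by rewrite mnmE inE si expr1.
  by move=> i /negbTE si; rewrite mnmE inE si expr0.
apply/funext => f; apply/propext; split.
  apply: (generated_min (J := sq (path_set t D))); first exact: submodule_sqfree.
  move=> _ [s [Ds ->]]; rewrite prodE //.
  by apply: generated_gen; exists [set x in s] => //; exists s.
apply: (generated_min (J := path_ideal k D t : R^o -> Prop)).
  exact: submodule_generated.
move=> _ [_ [s [Ds ->]] ->]; apply: generated_gen; exists s.
by rewrite prodE.
Qed.

Lemma resolution_sqfreeP (C : {set 'I_n} -> Prop) m :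
  (forall A, C A -> A != set0) ->
  projective_resolution_upto (sqfree_ideal C : R -> Prop) m <-> qdim_le m (sq C).
Proof.
move=> C0; apply: projective_resolution_uptoP; first exact: submodule_sqfree.
exact: sqfree_ideal_proper.
Qed.

End PathIdeals.

Theorem theorem3p7 (k : fieldType) (n : nat) (e : rel 'I_n) (r : 'I_n)
    (t : nat) (s : t.-tuple 'I_n) :
  tree e ->
  (2 <= t)%N ->
  let G := rooted_tree e r in
  let D := path_complex G t in
  properly_connected D ->
  dipath G s ->
  leaf e (last r s) ->
  let F := [set x in s] in
  let Y := \bigcup_(H in facets D | #|H :&: F| == t.-1) (H :\: F) in
  let Z := Y :|: F in
  let a := #|Y| in
  let G' := delete G [set last r s] in
  let G'' := delete G Z in
  pd (path_ideal k G t) =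
    maxe (pd (path_ideal k G' t)) (pd (path_ideal k G'' t) + (a%:Z + 1)%:E)%E.
Proof.
move=> treeE t2 G D Dconn Gs sleaf F Y Z a G' G''.
have t0 : (0 < t)%N by apply: ltnW.
have Gu q : dipath G q -> uniq q by apply: rooted_tree_uniq.
have delu S q : dipath (delete G S) q -> uniq q.
  by rewrite dipath_delete => /andP[/Gu].
set l := last r s; pose B := F :\ l.
have card A : path_set t G A -> #|A| = t by apply: path_set_card.
have facetE A : A \in facets D <-> path_set t G A by apply: path_facetsP.
have FG : path_set t G F by exists s.
have lF : l \in F.
  rewrite inE /l; have : last r s \in tval s; last by [].
  case: (tval s) (size_tuple s) => [t0'|x q _]; last by rewrite /= mem_last.
  by rewrite -t0' in t0.
(* Only [F] contains the leaf, so every other generator avoids its variable. *)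
have F_eq A : path_set t G A -> l \in A -> A = F.
  move=> [q [Gq ->]]; rewrite inE => lq; suff -> : q = s by [].
  by apply/val_inj/(rooted_tree_leaf treeE _ Gs) => //; rewrite !size_tuple.
have lB : l \notin B by rewrite !inE eqxx.
have FE : F = l |: B by rewrite setD1K.
have GE' A : path_set t G' A <-> path_set t G A /\ l \notin A.
  by rewrite path_set_delete disjoint_sym disjoints1.
have diffB (A : {set 'I_n}) : l \notin A -> A :\: B = A :\: F.
  move=> lA; apply/setP => x; rewrite !in_setD in_set1.
  by case: eqVneq => [->|//]; rewrite (negbTE lA) !andbF.
have YF y : y \in Y -> y \notin F.
  by case/bigcupP=> A _; rewrite inE => /andP[].
(* A facet contributing [y] leaves just [y] after division by the monomial of [B], so the variables
   of [Y] lie in the colon ideal. *)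
have YP y : y \in Y -> exists2 A, path_set t G' A & A :\: B = [set y].
  case/bigcupP=> A /andP[/facetE GA /eqP AF] yAF.
  have AFy : A :\: F = [set y].
    apply/eqP; rewrite eq_sym eqEcard sub1set yAF cards1 cardsD AF (card _ GA).
    by rewrite -[in X in (X - _)%N](prednK t0) subSnn.
  have lA : l \notin A.
    apply/negP => /(F_eq _ GA) AE; move: AFy; rewrite AE setDv => /esym/eqP.
    by apply/negP/set0Pn; exists y; rewrite set11.
  exists A; first exact/GE'.
  by rewrite diffB.
pose CK A := path_set t G'' A.
pose CY A := CK A \/ exists2 y, y \in enum Y & A = [set y].
(* The colon ideal is I_t(Gamma'') + (Y): a path avoiding the leaf either avoids [Z] or contains an
   element of [Y]. *)
have colE f : sqfree_ideal (fun A => exists2 H, path_set t G' H & A = H :\: B) f <->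
    sqfree_ideal CY (f : {mpoly k[n]}).
  split; apply: sqfree_ideal_sub => A; last first.
    move=> [/path_set_delete[GA]|[y]]; last first.
      rewrite mem_enum => /YP[H HG' HB] ->; exists [set y]; rewrite ?subxx //.
      by exists H.
    rewrite disjoints_subset => AZ; exists A; last exact: subxx.
    have AF : [disjoint A & F].
      by rewrite disjoints_subset (subset_trans AZ) // setCS subsetUr.
    exists A; first by apply/GE'; split=> //; apply: contraTN lF => /(disjointFr AF) ->.
    apply/esym/setDidPl; apply: disjointWr AF; exact: subD1set.
  move=> [H /GE'[GH lH] ->].
  have HF : H != F by apply: contraNneq lH => ->.
  have HBE := diffB H lH.
  have [HF0|HF0] := eqVneq (H :&: F) set0; last first.
    have [|A' [AD AF AH]] := properly_connected_penultimate t0 _ Dconn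
      ((facetE H).2 GH) ((facetE F).2 FG) HF0 HF; first by move=> A' /facetE/card.
    have [y yA] : exists y, y \in A' :\: F.
      apply/set0Pn; rewrite -card_gt0 cardsD AF card; last exact/facetE.
      by rewrite subn_gt0 prednK.
    have yY : y \in Y by apply/bigcupP; exists A'; rewrite ?AD ?AF /=.
    exists [set y]; first by right; exists y; rewrite ?mem_enum.
    by rewrite sub1set HBE inE YF // (subsetP AH).
  have [HY|] := boolP [disjoint H & Y].
    exists H; last by rewrite HBE (setDidPl _) // -setI_eq0 HF0.
    left; apply/path_set_delete; split=> //.
    rewrite disjoints_subset setCU subsetI -!disjoints_subset HY.
    by rewrite -setI_eq0 HF0 /=.
  rewrite -setI_eq0 => /set0Pn[y]; rewrite inE => /andP[yH yY].
  exists [set y]; first by right; exists y; rewrite ?mem_enum.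
  by rewrite sub1set HBE inE YF.
have ne (C : {set 'I_n} -> Prop) : (forall A, C A -> path_set t G A) ->
    forall A, C A -> A != set0.
  by move=> CG A /CG/card At; rewrite -card_gt0 At.
have neG := ne _ (fun A (x : path_set t G A) => x).
have neG' := ne (path_set t G') (fun A x => ((GE' A).1 x).1).
have neG'' := ne CK (fun A x => ((path_set_delete t G Z A).1 x).1).
have GsE f : sqfree_ideal (path_set t G) f <->
    sqfree_ideal (fun A => path_set t G' A \/ A = l |: B) (f : {mpoly k[n]}).
  rewrite -FE; split; apply: sqfree_ideal_sub => A.
    move=> GA; exists A => //.
    have [/(F_eq _ GA)|] := boolP (l \in A); first by right.
    by left; apply/GE'.
  by move=> [/GE'[GA _]|->]; [exists A|exists F].
rewrite !path_idealE // ?delu //; try exact: delu.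
rewrite -[(a%:Z + 1)]/((a + 1)%N%:Z) addn1.
apply: pd_max_shift => [m|L m j LE mj]; last first.
  have [C [C0 ->]] : exists C : {set 'I_n} -> Prop,
      (forall A, C A -> A != set0) /\ L = sqfree_ideal C.
    by case: LE => ->; [exists (path_set t G')|exists CK].
  rewrite !resolution_sqfreeP // -(subnKC mj); apply: qdim_le_add.
  exact: projective_unit.
(* For [m = 0] both sides fail: the ideal is nonzero, and the shift a + 1 is positive. *)
rewrite !resolution_sqfreeP //; case: m => [|p].
  by split=> [/(qdim_le0_sqfree neG FG)|[_ []]].
have lG' A : path_set t G' A -> l \notin A by move=> /GE'[].
have key := qdim_le_sqfree_add k p lG' lB.
have vars := qdim_le_sqfree_vars k p (enum_uniq (mem Y)) neG''.
have CKy A y : CK A -> y \in enum Y -> y \notin A.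
  move=> /path_set_delete[_ AZ]; rewrite mem_enum => yY.
  by apply/negP => /(disjointFr AZ); rewrite inE yY.
(* With m = p + 1, bound [p] for the colon ideal means a <= p together with bound p - a for
   [G'']. *)
rewrite subSS ltnS; rewrite -cardE in vars.
split=> [H|[HJ HK]].
  have /key[HJ Hc] : qdim_le p.+1 (sqfree_ideal
      (fun A => path_set t G' A \/ A = l |: B) : {mpoly k[n]}^o -> Prop).
    by apply: qdim_le_ext H => f; apply: GsE.
  split=> //; apply: (vars CKy).1.
  by apply: qdim_le_ext Hc => f; apply: colE.
apply: (@qdim_le_ext _ _ {mpoly k[n]}^o _ _ (fun f => iff_sym (GsE f))).
apply/key; split=> //.
apply: (@qdim_le_ext _ _ {mpoly k[n]}^o _ _ (fun f => iff_sym (colE f))).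
by apply/(vars CKy).
Qed.
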